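(* Let $m\geq 0$ be an integer, $0<\alpha\leq 1$ and $f\in C^{m,\alpha}(\mathbb{R}^d)$. Suppose that $\sigma$ is a compactly supported (signed) Borel measure on $\mathbb{R}^d$ of finite total variation such that $$\int_{\mathbb{R}^d} x^k\, d\sigma(x)=0$$ for any multiindex $k$ with $0\leq |k|\leq [m+\alpha]$. For $0<\varepsilon<1/2$ and $x\in\mathbb{R}^d$ let $$\Theta^{\sigma}_{\varepsilon}f(x):=\int_{\varepsilon}^1 \frac{\Delta_\sigma f(x,h)}{h^{m+\alpha}}\,\frac{dh}{h},\qquad \Delta_{\sigma}f(x,h):=\int_{\mathbb{R}^d} f(x+hw)\,d\sigma(w).$$ Then there exists a constant $C=C(m,d,\sigma)>0$ such that $$\limsup_{\varepsilon\to 0}\frac{|\Theta^{\sigma}_{\varepsilon}f(x)|}{\sqrt{\log(1/\varepsilon)\,\log\log\log(1/\varepsilon)}}\leq C\,\|f\|_{m,\alpha}$$ for almost all $x\in\mathbb{R}^d$.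
   Context: For $0<\alpha<1$, $\Lambda_\alpha(\mathbb{R}^d)$ is the space of functions $g:\mathbb{R}^d\to\mathbb{R}$ with $\|g\|_\alpha:=\sup \frac{|g(x+h)-g(x)|}{|h|^\alpha}<\infty$. For $\alpha=1$, $\Lambda_1(\mathbb{R}^d)$ is the Zygmund class: all continuous functions $g:\mathbb{R}^d\to\mathbb{R}$ with $\|g\|_1:=\sup\frac{|g(x+h)+g(x-h)-2g(x)|}{|h|}<\infty$. Both suprema are over all $x\in\mathbb{R}^d$ and $h\in\mathbb{R}^d\setminus\{0\}$. A multiindex is $k=(k_1,\dots,k_d)$ with integers $k_i\ge 0$; $|k|=k_1+\cdots+k_d$, $x^k=x_1^{k_1}\cdots x_d^{k_d}$, and $\partial^k$ is the corresponding partial derivative of order $|k|$. For an integer $m\ge 0$ and $0<\alpha\le 1$, $C^{m,\alpha}(\mathbb{R}^d)$ is the space of functions $f:\mathbb{R}^d\to\mathbb{R}$ that are $m$ times differentiable and all of whose derivatives of order $m$ belong to $\Lambda_\alpha(\mathbb{R}^d)$; $\|f\|_{m,\alpha}:=\sum_{|k|=m}\|\partial^k f\|_\alpha$. $[\beta]$ denotes the integer part of $\beta$ (the largest integer less than or equal to $\beta$). The notation $C=C(m,d,\sigma)$ means that the constant depends on $m$, $d$ and $\sigma$.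
   Formalization: The constant C is allowed to depend on α as well as on m, d and σ; a constant independent of α fails, e.g. for d=1, m=0, σ=δ_1−δ_0, α=1/M, f(x)=Σ_j 2^{-j}cos(2^{jM}x) as M→∞. *)

(* Defs.v *)
From HB Require Import structures.
From mathcomp Require Import all_boot all_order all_algebra.
From mathcomp Require Import all_classical all_reals all_analysis.

Set Implicit Arguments.
Unset Strict Implicit.
Unset Printing Implicit Defensive.

Import Order.TTheory GRing.Theory Num.Def Num.Theory.
Import numFieldNormedType.Exports.

Local Open Scope classical_set_scope.
Local Open Scope ring_scope.

Section Euclidean.
Context {R : realType} {d : nat}.
Implicit Types (x h a b : 'rV[R]_d) (A : set 'rV[R]_d).

(* The library norm on ['rV[R]_d] is the sup norm (same topology). *)
Definition enorm x : R := Num.sqrt (\sum_(i < d) x 0 i ^+ 2).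

Definition box a b : set 'rV[R]_d :=
  [set x | forall i, a 0 i <= x 0 i <= b 0 i].

Definition box_volume a b : \bar R := (\prod_(i < d) (b 0 i - a 0 i))%:E.

(* Lebesgue outer measure on R^d: infimum of the total volume over the
   countable covers by boxes. *)
Definition lebesgue_outer A : \bar R :=
  ereal_inf [set v | exists2 ab : nat -> 'rV[R]_d * 'rV[R]_d,
    (forall n i, (ab n).1 0 i <= (ab n).2 0 i) /\
    A `<=` \bigcup_n box (ab n).1 (ab n).2 &
    v = (\sum_(0 <= n <oo) box_volume (ab n).1 (ab n).2)%E].

Definition lebesgue_almost_all (P : 'rV[R]_d -> Prop) : Prop :=
  lebesgue_outer [set x | ~ P x] = 0%E.

End Euclidean.

(* R^d with its Borel sigma-algebra; convertible to ['rV[R]_d] *)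
Notation borel_rV R d := (g_sigma_algebraType (@open 'rV[R]_d)).

Section SignedMeasure.
Context {dis : measure_display} {T : measurableType dis} {R : realType}.
Variable sigma : {charge set T -> \bar R}.

(* A choice of Hahn decomposition; the Jordan parts, hence the variation and
   the integral below, do not depend on it (Hahn_decomposition_uniq). *)
Definition hahn_sets : {PN : set T * set T | hahn_decomposition sigma PN.1 PN.2}.
Proof.
apply: cid; have [P [N PN]] := Hahn_decomposition sigma.
by exists (P, N).
Defined.

Definition charge_pos : {finite_measure set T -> \bar R} :=
  jordan_pos (proj2_sig hahn_sets).

Definition charge_neg : {finite_measure set T -> \bar R} :=
  jordan_neg (proj2_sig hahn_sets).

Definition total_variation : {measure set T -> \bar R} :=
  charge_variation (proj2_sig hahn_sets).

Definition charge_integral (f : T -> R) : R :=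
  \int[charge_pos]_x f x - \int[charge_neg]_x f x.

End SignedMeasure.

(* A {charge _} takes finite values, so it has finite total variation. *)
Definition compactly_supported (R : realType) (d : nat)
    (sigma : {charge set (borel_rV R d) -> \bar R}) : Prop :=
  exists2 K : set 'rV[R]_d, compact K & total_variation sigma (~` K) = 0%E.

Section HolderSpaces.
Context {R : realType} {d : nat}.
Implicit Types (f g : 'rV[R]_d -> R) (k : 'I_d -> nat) (alpha : R).

Definition multi_order k : nat := (\sum_(i < d) k i)%N.

Definition monomial k (x : 'rV[R]_d) : R := \prod_(i < d) x 0 i ^+ k i.

Definition partial (i : 'I_d) f : 'rV[R]_d -> R := 'D_(delta_mx 0 i) f.

Definition multi_partial k f : 'rV[R]_d -> R :=
  foldr (fun i g => iter (k i) (partial i) g) f (enum 'I_d).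

Definition holder_quotient alpha g (x h : 'rV[R]_d) : R :=
  if alpha == 1 then `|g (x + h) + g (x - h) - 2 * g x| / enorm h
  else `|g (x + h) - g x| / enorm h `^ alpha.

Definition holder_seminorm alpha g : \bar R :=
  ereal_sup [set q | exists2 xh : 'rV[R]_d * 'rV[R]_d,
    xh.2 != 0 & q = (holder_quotient alpha g xh.1 xh.2)%:E].

Definition holder alpha g : Prop :=
  (alpha = 1 -> continuous g) /\ (holder_seminorm alpha g < +oo)%E.

Fixpoint times_differentiable (m : nat) f : Prop :=
  if m is m'.+1 then
    (forall x, differentiable f x) /\
    (forall i, times_differentiable m' (partial i f))
  else True.

Definition holder_space (m : nat) alpha f : Prop :=
  times_differentiable m f /\
  forall k, multi_order k = m -> holder alpha (multi_partial k f).

(* |k| = m forces k_i <= m, so the multiindices range over a finite type *)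
Definition holder_space_norm (m : nat) alpha f : \bar R :=
  (\sum_(k : {ffun 'I_d -> 'I_m.+1} | multi_order (fun i => k i) == m)
    holder_seminorm alpha (multi_partial (fun i => k i) f))%E.

Variable sigma : {charge set (borel_rV R d) -> \bar R}.

Definition Delta f (x : 'rV[R]_d) (h : R) : R :=
  charge_integral sigma (fun w : 'rV[R]_d => f (x + h *: w)).

Definition Theta (m : nat) alpha (eps : R) f (x : 'rV[R]_d) : R :=
  \int[lebesgue_measure]_(h in `[eps, 1])
    (Delta f x h / h `^ (m%:R + alpha) / h).

End HolderSpaces.

(* Main.v *)
Require Import Defs.
From HB Require Import structures.
From mathcomp Require Import all_boot all_order all_algebra.
From mathcomp Require Import all_classical all_reals all_analysis.
From mathcomp Require Import measurable_realfun ring lra zify.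

Set Implicit Arguments.
Unset Strict Implicit.
Unset Printing Implicit Defensive.

Import Order.TTheory GRing.Theory Num.Def Num.Theory.
Import numFieldNormedType.Exports.

Local Open Scope classical_set_scope.
Local Open Scope ring_scope.

(** Cut the interval of integration at the powers of 2: up to one bounded term,
[Theta] at [2 ^- n] is the sum [S n] of the integrals over the first [n] dyadic
intervals of scales, each bounded by a multiple of the seminorm of [f].  Over a
cube of side [2 ^- i] the first [i] integrals vary little, and the mean of the
later ones is small because [sigma] kills the polynomials of degree at most
[m] (at most [m + 1] if [alpha = 1]).  Both effects decay geometrically away
from the scale of the cube.  Hence the means of [S N] over the cubes of a
dyadic tree form a martingale with bounded increments which stays within a
bounded distance of the sequence [S i], and the theorem is the upper half of
the law of the iterated logarithm for such a martingale.

The probabilistic half is [iterated_logarithm].  An exponential bound is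
propagated from the leaves of the tree to its root
([cover_large_partial_sums]).  Within a unit cube it covers the set where one of
the first [N] sums exceeds [t] by finitely many boxes of total volume of order
[exp (- a * t ^+ 2 / N)] for some [a > 0], and the lemma of Borel and Cantelli is
applied along [N = 2 ^ k].  The null sets of the statement being defined by
covers, all of this is a count of dyadic cubes.  Accordingly, the means are
taken over the points of a fine grid.

The analytic half is [partial_sum_means].  Three estimates at one scale
([segment_le] for the size, [segment_diff_le] for the variation over a cube,
[segment_mean_le] for the mean over a larger cube) are instances of
[segment_estimate]: if a combination of translates of the derivatives of order
[m] of [f] is close to constants (to affine functions if [alpha = 1]), then that
combination of translates of [f] is close to a polynomial killed by [sigma].
The polynomial is constructed in [polynomial_approx].

The derivatives enter through [holder_approx]: after subtraction of an affine
function adapted to a cube, they satisfy a Hoelder condition there with an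
exponent [beta < 1], also in the Zygmund class.  For the means, the
difference of the mean and of its translate lives on opposite faces of the cube
([grid_mean_telescope]), which gains a factor [r / l] for a translation by [r]
in a cube of side [l] ([grid_mean_affine_approx]).  For [alpha < 1] this leaves
the decay [(r / l) `^ (1 - alpha)].  For [alpha = 1] there is no room left, and
the decay comes from [beta]: the leading term of the difference is linear,
hence killed by [sigma] too. *)

(** * Finite covers by boxes and null sets *)

Section Covers.
Context {R : realType} {d : nat}.
Implicit Types (A B : set 'rV[R]_d) (ab : 'rV[R]_d * 'rV[R]_d).

Definition vol ab : R := \prod_(i < d) (ab.2 0 i - ab.1 0 i).

Definition wf_box ab : Prop := forall i, ab.1 0 i <= ab.2 0 i.

Definition finitely_covered A (v : R) : Prop :=
  exists2 s : seq ('rV[R]_d * 'rV[R]_d),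
    (forall ab, ab \in s -> wf_box ab) /\
    (forall x, A x -> exists2 ab, ab \in s & box ab.1 ab.2 x) &
    \sum_(ab <- s) vol ab <= v.

Lemma vol_ge0 ab : wf_box ab -> 0 <= vol ab.
Proof. by move=> wab; apply: prodr_ge0 => i _; rewrite subr_ge0. Qed.

Lemma finitely_covered_sub A B v w :
  A `<=` B -> v <= w -> finitely_covered B v -> finitely_covered A w.
Proof.
move=> AB vw [s [ws Bs] sv]; exists s; last exact: le_trans vw.
by split=> // x /AB /Bs.
Qed.

Lemma finitely_covered_set0 v : 0 <= v -> finitely_covered set0 v.
Proof. by move=> v0; exists [::]; [split|rewrite big_nil]. Qed.

Lemma finitely_covered_union (I : eqType) (r : seq I) (A : I -> set 'rV[R]_d)
    (v : I -> R) :
  (forall i, i \in r -> finitely_covered (A i) (v i)) ->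
  finitely_covered [set x | exists2 i, i \in r & A i x] (\sum_(i <- r) v i).
Proof.
elim: r => [|i r IH] Ar.
  by exists [::]; [split=> // x [i]|rewrite !big_nil].
have [s [ws As] sv] := Ar i (mem_head _ _).
have [|s' [ws' As'] sv'] := IH.
  by move=> j jr; apply: Ar; rewrite inE jr orbT.
exists (s ++ s'); last by rewrite big_cat big_cons lerD.
split=> [ab|x [j]]; first by rewrite mem_cat => /orP[/ws|/ws'].
rewrite inE => /orP[/eqP-> /As[ab abs xab]|jr Ajx].
  by exists ab => //; rewrite mem_cat abs.
have [ab abs xab] : exists2 ab, ab \in s' & box ab.1 ab.2 x.
  by apply: As'; exists j.
by exists ab => //; rewrite mem_cat abs orbT.
Qed.

Lemma finitely_covered_box ab :
  wf_box ab -> finitely_covered (box ab.1 ab.2) (vol ab).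
Proof.
move=> wab; exists [:: ab]; last by rewrite big_seq1.
split=> [cd|x xab]; first by rewrite inE => /eqP->.
by exists ab; rewrite ?inE.
Qed.

Lemma lebesgue_outer_ge0 A : (0 <= lebesgue_outer A)%E.
Proof.
apply: le_ereal_inf_tmp => _ [ab [wab _] ->].
by apply: nneseries_ge0 => n _ _; rewrite lee_fin; apply: vol_ge0.
Qed.

(** In positive dimension there is a box of volume zero.  It is added to each
finite list of boxes, and the lists are concatenated to one sequence. *)
Lemma lebesgue_outer_eq0 A : (0 < d)%N ->
  (forall e : R, 0 < e -> exists2 B : nat -> set 'rV[R]_d, A `<=` \bigcup_n B n &
     exists2 v : nat -> R, forall n, finitely_covered (B n) (v n) &
       forall n, \sum_(i < n) v i <= e) ->
  lebesgue_outer A = 0%E.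
Proof.
move=> d0 Acov; apply/eqP; rewrite eq_le lebesgue_outer_ge0 andbT.
apply/lee_addgt0Pr => e e0; rewrite add0e.
have [B AB [v Bv ve]] := Acov e e0.
pose p0 : 'rV[R]_d * 'rV[R]_d := (0, 0).
have wfp0 : wf_box p0 by move=> j; rewrite lexx.
have v0 : vol p0 = 0.
  by rewrite /vol (bigD1 (Ordinal d0))//= !mxE subr0 mul0r.
have /choice[s sP] : forall n, exists s : seq ('rV[R]_d * 'rV[R]_d),
    [/\ (0 < size s)%N, forall ab, ab \in s -> wf_box ab,
        forall x, B n x -> exists2 ab, ab \in s & box ab.1 ab.2 x &
        \sum_(ab <- s) vol ab <= v n].
  move=> n; have [s [ws Bs] sv] := Bv n; exists (p0 :: s); split=> //.
  - by move=> ab; rewrite inE => /orP[/eqP->|/ws].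
  - by move=> x /Bs[ab abs xab]; exists ab => //; rewrite inE abs orbT.
  - by rewrite big_cons v0 add0r.
(* As no list is empty, the first [n] lists together contain at least [n]
   boxes, so that the [k]-th box of the sequence is found in [F k.+1]. *)
pose F n := flatten (mkseq s n).
have FS n : F n.+1 = F n ++ s n.
  by rewrite /F /mkseq -(addn1 n) iotaD map_cat flatten_cat /= cats0.
have Fle n m : (n <= m)%N -> exists t, F m = F n ++ t.
  elim: m => [|m IH]; first by rewrite leqn0 => /eqP->; exists [::]; rewrite cats0.
  rewrite leq_eqVlt => /orP[/eqP->|/IH[t Ft]]; first by exists [::]; rewrite cats0.
  by exists (t ++ s m); rewrite FS Ft catA.
have sF n : (n <= size (F n))%N.
  elim: n => // n IH; rewrite FS size_cat -(addn1 n) leq_add//.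
  by have [] := sP n.
have wF n ab : ab \in F n -> wf_box ab.
  elim: n => // n IH; rewrite FS mem_cat => /orP[/IH//|].
  by have [_ + _ _] := sP n; exact.
pose G k := nth p0 (F k.+1) k.
have GF k n : (k < size (F n))%N -> G k = nth p0 (F n) k.
  move=> kn; rewrite /G; have [le|le] := leqP k.+1 n.
    by have [t ->] := Fle _ _ le; rewrite nth_cat (sF k.+1).
  by have [t ->] := Fle _ _ (ltnW le); rewrite nth_cat kn.
have wG k : wf_box (G k) by apply: (wF k.+1); rewrite mem_nth// (sF k.+1).
apply: (@le_trans _ _ (\sum_(0 <= n <oo) box_volume (G n).1 (G n).2)%E).
  apply: ereal_inf_lbound => /=; exists G => //; split=> // x /AB[n _ Bnx].
  have [_ _ /(_ x Bnx)[ab abs xab] _] := sP n.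
  have abF : ab \in F n.+1 by rewrite FS mem_cat abs orbT.
  exists (index ab (F n.+1)) => //.
  by rewrite (GF _ n.+1) ?index_mem// nth_index.
apply: lime_le; first by apply: is_cvg_nneseries => n _ _; rewrite lee_fin vol_ge0.
near=> n; rewrite sumEFin lee_fin; apply: le_trans (ve n).
apply: (@le_trans _ _ (\sum_(ab <- F n) vol ab)); last first.
  elim: (n) => [|k IH]; first by rewrite /F big_nil big_ord0.
  by rewrite FS big_cat big_ord_recr lerD//; have [] := sP k.
rewrite (big_nth p0) (big_cat_nat _ (sF n))//= big_nat_cond.
rewrite (eq_bigr (fun k => vol (nth p0 (F n) k))); last first.
  by move=> k; rewrite andbT => kn; rewrite -GF// (leq_trans _ (sF n)).
rewrite -big_nat_cond lerDl big_nat_cond sumr_ge0// => k; rewrite andbT => /andP[_ kF].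
by apply: vol_ge0; apply: (wF n); rewrite mem_nth.
Unshelve. all: by end_near. Qed.

End Covers.

(** * Exponential bounds along trees of dyadic cubes *)

Section Exponential.
Context {R : realType}.
Implicit Types x y z : R.

(** When [y] is averaged over a variable of mean zero the linear term
disappears: this gives the exponential moment of a bounded martingale
increment.  The two sides agree at [0], and the factor [2] makes the proof by
[(1 - y)^-1] work up to [y = 1/2]. *)
Lemma expR_le_id_expR_sqr y : expR y <= y + expR (2 * y ^+ 2).
Proof.
have [y12|y12] := lerP y 2^-1; last first.
  apply: (@le_trans _ _ (expR (2 * y ^+ 2))); last by lra.
  by rewrite ler_expR; nra.
have h1 : expR y <= (1 - y)^-1.
  rewrite -[leLHS]invrK -expRN lef_pV2 ?posrE ?expR_gt0//; last by lra.
  exact: expR_ge1Dx.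
apply: (le_trans h1).
have h2 : (1 - y)^-1 <= 1 + y + 2 * y ^+ 2.
  by rewrite -div1r ler_pdivrMr; nra.
have := expR_ge1Dx (2 * y ^+ 2); lra.
Qed.

End Exponential.

Section DyadicTree.
Context {R : realType} {d : nat}.
Implicit Types (x y : 'rV[R]_d) (a : {ffun 'I_d -> bool}).

Definition side (i : nat) : R := 2^-1 ^+ i.

Definition bits a : 'rV[R]_d := \row_j (a j)%:R.

Definition cube (s : R) y : set 'rV[R]_d := box y (y + const_mx s).

Lemma side_gt0 i : 0 < side i. Proof. by rewrite exprn_gt0// invr_gt0. Qed.

Lemma sideS i : side i = 2 * side i.+1.
Proof. by rewrite /side exprS mulrA mulfV// mul1r. Qed.

Lemma cubeP s y x : cube s y x <-> forall i, y 0 i <= x 0 i <= y 0 i + s.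
Proof. by split=> h i; have := h i; rewrite !mxE. Qed.

Lemma finitely_covered_cube s y : 0 <= s -> finitely_covered (cube s y) (s ^+ d).
Proof.
move=> s0; have := @finitely_covered_box R d (y, y + const_mx s).
rewrite /vol /= => /(_ _)/wrap[|]; first by move=> i; rewrite !mxE lerDl.
rewrite (eq_bigr (fun=> s)); last by move=> i _; rewrite !mxE addrAC subrr add0r.
by rewrite prodr_const card_ord.
Qed.

Lemma cube_split s y x : cube (2 * s) y x ->
  exists a, cube s (y + s *: bits a) x.
Proof.
move=> /cubeP yx; exists [ffun i => y 0 i + s <= x 0 i]; apply/cubeP => i.
rewrite !mxE ffunE; have := yx i.
by case: (lerP (y 0 i + s) (x 0 i)) => /=; rewrite ?mulr1 ?mulr0; lra.
Qed.

Lemma card_bits : (#|{ffun 'I_d -> bool}| = 2 ^ d)%N.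
Proof. by rewrite card_ffun card_bool card_ord. Qed.

(** Maximal inequality and Azuma inequality in one induction.  If the mean
[X i y] is at least [t - c], then the right-hand side is at least the volume
of the cube.  Otherwise [S i] itself does not exceed [t] on the cube, so that
every point of the set lies in the corresponding set for one of the children,
and the bounds for the children are averaged.  An increment of [X] from a cube
to a child is at most [3 * c], by comparison with [S] at the corner. *)
Lemma cover_large_partial_sums (N : nat) (c t l : R)
    (S X : nat -> 'rV[R]_d -> R) : 0 <= c -> 0 <= l ->
  (forall i y, (i < N)%N ->
     X i y = 2^-1 ^+ d * \sum_a X i.+1 (y + side i.+1 *: bits a)) ->
  (forall i y x, (i <= N)%N -> cube (side i) y x -> `|S i x - X i y| <= c) ->
  (forall i x, `|S i.+1 x - S i x| <= c) ->
  forall n i y, (i + n = N)%N ->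
  finitely_covered
    [set x | cube (side i) y x /\ exists j, (i <= j <= N)%N /\ t < S j x]
    (side i ^+ d * expR (- l * (t - c - X i y) + 2 * (3 * c * l) ^+ 2 *+ n)).
Proof.
move=> c0 l0 XE SX SS; elim=> [|n IH] i y iN.
all: have [tX|tX] := lerP (t - c - X i y) 0.
- apply: (@finitely_covered_sub _ _ _ (cube (side i) y) (side i ^+ d)).
  + by move=> x [].
  + rewrite ler_pMr ?exprn_gt0 ?side_gt0// -expR0 ler_expR mulr0n.
    by rewrite addr0 mulNr oppr_ge0 mulr_ge0_le0.
  + exact: finitely_covered_cube (ltW (side_gt0 i)).
- apply: (@finitely_covered_sub _ _ _ set0 _ _ _ (lexx _)).
    move=> x [yx [j [ij tS]]]; have ji : j = i by lia.
    have := SX i y x; rewrite -iN addn0 leqnn => /(_ isT yx).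
    by rewrite ler_norml; move: tS; rewrite ji; lra.
  by apply: finitely_covered_set0; rewrite mulr_ge0 ?expR_ge0 ?exprn_ge0 ?ltW ?side_gt0.
- apply: (@finitely_covered_sub _ _ _ (cube (side i) y) (side i ^+ d)).
  + by move=> x [].
  + rewrite ler_pMr ?exprn_gt0 ?side_gt0// -expR0 ler_expR.
    rewrite addr_ge0//; first by rewrite mulNr oppr_ge0 mulr_ge0_le0.
    by rewrite mulrn_wge0// mulr_ge0// sqr_ge0.
  + exact: finitely_covered_cube (ltW (side_gt0 i)).
- pose y' a := y + side i.+1 *: bits a.
  have iN' : (i < N)%N by lia.
  have SiN : (i.+1 + n = N)%N by lia.
  set E := expR (- l * (t - c - X i y) + 2 * (3 * c * l) ^+ 2 *+ n).
  have y'y a : cube (side i) y (y' a).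
    apply/cubeP => j; rewrite !mxE (sideS i); have := side_gt0 i.+1.
    by case: (a j); rewrite /= ?mulr1 ?mulr0; lra.
  have y'y' a : cube (side i.+1) (y' a) (y' a).
    by apply/cubeP => j; rewrite lexx lerDl ltW// side_gt0.
  have DX a : `|X i.+1 (y' a) - X i y| <= 3 * c.
    have := SX i y _ (ltnW iN') (y'y a); have := SX _ _ _ iN' (y'y' a).
    have := SS i (y' a); rewrite !ler_norml; lra.
  have sumX : \sum_a (X i.+1 (y' a) - X i y) = 0.
    rewrite big_split/= sumr_const card_bits XE//.
    rewrite -[X in _ + X]mulr_natr natrX exprVn mulNr mulrAC mulVf ?mul1r ?subrr//.
  have := @finitely_covered_union R d _ (index_enum {ffun 'I_d -> bool}) _ _
    (fun a _ => IH i.+1 (y' a) SiN).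
  apply: finitely_covered_sub.
    move=> x [yx [j [ij tS]]]; rewrite /= (sideS i) in yx.
    have [a ax] := cube_split yx; exists a; first by rewrite mem_index_enum.
    split=> //; exists j; split=> //; rewrite ltn_neqAle -andbA ij andbT.
    apply/eqP => ji; have := SX i y x (ltnW iN').
    by rewrite (sideS i) => /(_ yx); rewrite ler_norml; move: tS; rewrite -ji; lra.
  have -> : \sum_a (side i.+1 ^+ d * expR (- l * (t - c - X i.+1 (y' a)) +
      2 * (3 * c * l) ^+ 2 *+ n)) =
      side i.+1 ^+ d * E * \sum_a expR (l * (X i.+1 (y' a) - X i y)).
    rewrite mulr_sumr; apply: eq_bigr => a _.
    by rewrite -[RHS]mulrA /E -expRD; congr (_ * expR _); ring.
  have h : \sum_a expR (l * (X i.+1 (y' a) - X i y)) <=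
      2 ^+ d * expR (2 * (3 * c * l) ^+ 2).
    apply: (@le_trans _ _ (\sum_a (l * (X i.+1 (y' a) - X i y) +
        expR (2 * (3 * c * l) ^+ 2)))).
      apply: ler_sum => a _; apply: (le_trans (expR_le_id_expR_sqr _)).
      rewrite lerD2l ler_expR ler_wpM2l// -[leLHS]real_normK ?num_real//.
      rewrite lerXn2r ?nnegrE ?mulr_ge0// normrM (ger0_norm l0) mulrC.
      by rewrite ler_wpM2r.
    rewrite big_split/= -mulr_sumr sumX mulr0 add0r sumr_const card_bits.
    by rewrite -natrX [leRHS]mulr_natl.
  apply: (le_trans (ler_wpM2l _ h)).
    by rewrite mulr_ge0 ?expR_ge0 ?exprn_ge0 ?ltW ?side_gt0.
  rewrite mulrACA -exprMn [_ * 2]mulrC -sideS ler_wpM2l//.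
    by rewrite exprn_ge0 ?ltW ?side_gt0.
  by rewrite /E -expRD -addrA -mulrSr.
Qed.

End DyadicTree.

(** * The law of the iterated logarithm *)

Section IteratedLogarithm.
Context {R : realType} {d : nat}.
Implicit Types (x y : 'rV[R]_d).

Lemma unit_cube_of_point (k : nat) x :
  (forall i, - k%:R <= x 0 i < k%:R) ->
  exists g : {ffun 'I_d -> 'I_(2 * k)},
    cube 1 (\row_i ((g i)%:R - k%:R)) x.
Proof.
move=> xk; have k0 i : 0 <= x 0 i + k%:R by have := xk i; lra.
have xlt i : (Num.truncn (x 0 i + k%:R)%R < 2 * k)%N.
  by rewrite truncn_lt_nat// natrM; have := xk i; lra.
exists [ffun i => Ordinal (xlt i)]; apply/cubeP => i; rewrite mxE ffunE /=.
have := truncn_itv (k0 i); rewrite -natr1; lra.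
Qed.

Lemma cover_large_partial_sums_box (k N : nat) (c tau : R)
    (S X : nat -> 'rV[R]_d -> R) : 0 < c -> 0 <= tau -> (0 < N)%N ->
  (forall x, S 0 x = 0) ->
  (forall i y, (i < N)%N ->
     X i y = 2^-1 ^+ d * \sum_a X i.+1 (y + side i.+1 *: bits a)) ->
  (forall i y x, (i <= N)%N -> cube (side i) y x -> `|S i x - X i y| <= c) ->
  (forall i x, `|S i.+1 x - S i x| <= c) ->
  finitely_covered
    [set x : 'rV[R]_d | (forall i, - k%:R <= x 0 i < k%:R) /\
       exists j, (j <= N)%N /\ 2 * c + tau < S j x]
    ((2 * k%:R) ^+ d * expR (- (tau ^+ 2 / (72 * c ^+ 2 * N%:R)))).
Proof.
move=> c0 tau0 N0 S0 XE SX SS.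
have N0R : (0 : R) < N%:R by rewrite ltr0n.
(* The minimizer of [- l * tau + 2 * (3 * c * l) ^+ 2 * N]. *)
pose l := tau / (36 * c ^+ 2 * N%:R).
have l0 : 0 <= l by rewrite divr_ge0// !mulr_ge0// ?sqr_ge0// ltW.
pose q (g : {ffun 'I_d -> 'I_(2 * k)}) : 'rV[R]_d := \row_i ((g i)%:R - k%:R).
have Xq g : `|X 0%N (q g)| <= c.
  rewrite -normrN -[- _]add0r -(S0 (q g)); apply: SX => //.
  by apply/cubeP => i; rewrite lexx lerDl ltW// side_gt0.
have := @finitely_covered_union R d _ (index_enum {ffun 'I_d -> 'I_(2 * k)}) _ _
  (fun g _ => cover_large_partial_sums (2 * c + tau) (ltW c0) l0 XE SX SS
     (i := 0) (n := N) (q g) (add0n _)).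
apply: finitely_covered_sub.
  move=> x [xk [j [jN tS]]]; have [g gx] := unit_cube_of_point xk.
  by exists g; [rewrite mem_index_enum|split=> //; exists j; rewrite leq0n].
apply: (@le_trans _ _ (\sum_(g : {ffun 'I_d -> 'I_(2 * k)})
    expR (- (tau ^+ 2 / (72 * c ^+ 2 * N%:R))))).
  apply: ler_sum => g _; rewrite /side expr0 expr1n mul1r ler_expR.
  have h : - l * (2 * c + tau - c - X 0%N (q g)) <= - l * tau.
    rewrite !mulNr lerN2 ler_wpM2l//.
    by have := Xq g; rewrite ler_norml; lra.
  apply: (le_trans (lerD h (lexx _))).
  rewrite le_eqVlt; apply/orP; left; apply/eqP; rewrite /l.
  rewrite -mulr_natr; field.
  by rewrite !gt_eqF.
by rewrite sumr_const card_ffun !card_ord -[leLHS]mulr_natl natrX natrM.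
Qed.

(** The factor [d.+3] turns the exponential bound for [2 ^ k] steps into
[k ^- d.+3]: the power [d] pays for the cubes that cover [[-k, k[^d], and the
remaining third power is summable. *)
Definition deviation (k : nat) : R :=
  Num.sqrt (72 * (d.+3)%:R * 2 ^+ k * ln k%:R).

(** The Borel-Cantelli argument along the lengths [2 ^ k].  The cube
[[-k, k[^d] is treated together with the length [2 ^ k], since every point
belongs to these cubes from some [k] on. *)
Theorem iterated_logarithm (c : R) (S : nat -> 'rV[R]_d -> R) :
  (0 < d)%N -> 0 < c -> (forall x, S 0%N x = 0) ->
  (forall i x, `|S i.+1 x - S i x| <= c) ->
  (forall N, exists X : nat -> 'rV[R]_d -> R,
    (forall i y, (i < N)%N ->
       X i y = 2^-1 ^+ d * \sum_a X i.+1 (y + side i.+1 *: bits a)) /\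
    (forall i y x, (i <= N)%N -> cube (side i) y x -> `|S i x - X i y| <= c)) ->
  lebesgue_almost_all (fun x => exists k0, forall k, (k0 <= k)%N ->
    forall j, (j <= 2 ^ k)%N -> `|S j x| <= c * (2 + deviation k)).
Proof.
move=> d0 c0 S0 SS SX; apply: lebesgue_outer_eq0 => // e e0.
pose bad k : set 'rV[R]_d := [set x : 'rV[R]_d | (forall i, - k%:R <= x 0 i < k%:R) /\
  exists2 b : bool, b \in [:: true; false] &
    exists j, (j <= 2 ^ k)%N /\ c * (2 + deviation k) < (-1) ^+ b * S j x].
have badP k : (2 <= k)%N ->
    finitely_covered (bad k) (2 ^+ d.+1 * ((k.-1)%:R^-1 - k%:R^-1)).
  move=> k2; have k0 : (0 : R) < k%:R by rewrite ltr0n; lia.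
  have [X [XE SXc]] := SX (2 ^ k)%N.
  have lnk : 0 <= ln (k%:R : R) by rewrite ln_ge0// ler1n; lia.
  pose v := ((2 * k%:R) ^+ d * expR (- ((c * deviation k) ^+ 2 /
    (72 * c ^+ 2 * (2 ^ k)%:R)))) : R.
  have vE : v = 2 ^+ d * k%:R ^- 3.
    rewrite /v /deviation [(c * _) ^+ 2]exprMn sqr_sqrtr; last first.
      by rewrite !mulr_ge0// exprn_ge0.
    rewrite natrX.
    have -> : c ^+ 2 * (72 * (d.+3)%:R * 2 ^+ k * ln k%:R) / (72 * c ^+ 2 * 2 ^+ k)
       = (d.+3)%:R * ln (k%:R : R).
      by field; rewrite expf_neq0// gt_eqF.
    rewrite expRN expRM_natl lnK ?posrE// exprMn -mulrA; congr (_ * _).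
    rewrite -[d.+3]/(3 + d)%N exprD invfM mulrCA mulfV ?mulr1//.
    by rewrite expf_neq0// gt_eqF.
  have := @finitely_covered_union R d bool [:: true; false] (fun b => [set x : 'rV[R]_d |
     (forall i, - k%:R <= x 0 i < k%:R) /\ exists j, (j <= 2 ^ k)%N /\
       2 * c + c * deviation k < (-1) ^+ b * S j x]) (fun=> v).
  move=> /(_ _)/wrap[b _|].
    apply: (@cover_large_partial_sums_box k _ c _ (fun j x => (-1) ^+ b * S j x)
      (fun j x => (-1) ^+ b * X j x)) => //.
    - by rewrite mulr_ge0 ?sqrtr_ge0// ltW.
    - by rewrite expn_gt0.
    - by move=> x; rewrite S0 mulr0.
    - by move=> i y iN; rewrite XE// mulrCA mulr_sumr.
    - by move=> i y x iN yx; rewrite -mulrBr normrM normr_sign mul1r SXc.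
    - by move=> i x; rewrite -mulrBr normrM normr_sign mul1r.
  apply: finitely_covered_sub.
    move=> x [xk [b bb [j [jk h]]]]; exists b => //; split=> //; exists j.
    by split=> //; rewrite (mulrC 2) -mulrDr.
  rewrite !big_cons big_nil addr0 -mulr2n -[leLHS]mulr_natl vE mulrA -exprS.
  rewrite ler_wpM2l ?exprn_ge0//.
  have [n kn] : exists n, k = n.+2 by exists k.-2; lia.
  rewrite kn /= -(natr1 n.+1); set u : R := n.+1%:R.
  have u1 : 1 <= u by rewrite ler1n.
  rewrite (_ : u^-1 - _ = (u * (u + 1))^-1); last by field; lra.
  rewrite lef_pV2 ?posrE; nra.
(* The bounds of [badP] telescope to [2 ^+ d.+1 / K.-1] from [K] on. *)
pose K := (Num.truncn (2 ^+ d.+1 / e)).+2.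
exists (fun n => bad (K + n)%N).
  move=> x /= /forallNP Sx.
  have [M xM] : exists M : nat, forall i, `|x 0 i| < M%:R.
    exists (\max_i (Num.truncn `|x 0%R i|).+1)%N => i.
    apply: (lt_le_trans (truncnS_gt _)); rewrite ler_nat.
    exact: (@leq_bigmax _ (fun i => (Num.truncn `|x 0%R i|).+1)).
  have /existsNP[k /not_implyP[Kk /existsNP[j /not_implyP[jk /negP]]]] :=
    Sx (K + M)%N.
  rewrite -ltNge => Sk; exists (k - K)%N => //.
  rewrite subnKC; last by lia.
  split=> [i|].
    have Mk : M%:R <= k%:R :> R by rewrite ler_nat; lia.
    by have := xM i; rewrite ltr_norml; lra.
  exists (S j x < 0); first by case: (_ < _).
  by exists j; split=> //; rewrite -normrEsign.
exists (fun n => 2 ^+ d.+1 * ((K + n).-1%:R^-1 - (K + n)%:R^-1)).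
  by move=> n; apply: badP; rewrite /K; lia.
move=> n; rewrite -mulr_sumr.
have -> : \sum_(i < n) ((K + i).-1%:R^-1 - (K + i)%:R^-1) =
    K.-1%:R^-1 - (K + n).-1%:R^-1 :> R.
  elim: n => [|n IH]; first by rewrite big_ord0 addn0 subrr.
  rewrite big_ord_recr IH /= addnS /=; ring.
apply: (@le_trans _ _ (2 ^+ d.+1 * K.-1%:R^-1)).
  by rewrite ler_wpM2l ?exprn_ge0// gerBl invr_ge0.
rewrite ler_pdivrMr ?ltr0n// mulrC -ler_pdivrMr//.
by apply: ltW; rewrite /K /= truncnS_gt.
Qed.

End IteratedLogarithm.

(** * Regularity of Hoelder and Zygmund functions on a cube *)

Section Regularity.
Context {R : realType} {d : nat}.
Implicit Types (u v w : 'rV[R]_d -> R) (x y z p q b : 'rV[R]_d).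

Definition supnorm_le (r : R) z : Prop := forall i, `|z 0 i| <= r.

Definition lin b z : R := \sum_i b 0 i * z 0 i.

Lemma lin0 z : lin 0 z = 0.
Proof. by rewrite /lin big1// => i _; rewrite mxE mul0r. Qed.

Lemma linr0 b : lin b 0 = 0.
Proof. by rewrite /lin big1// => i _; rewrite mxE mulr0. Qed.

Lemma linD b y z : lin b (y + z) = lin b y + lin b z.
Proof. by rewrite -big_split; apply: eq_bigr => i _; rewrite mxE mulrDr. Qed.

Lemma linN b z : lin b (- z) = - lin b z.
Proof. by rewrite -sumrN; apply: eq_bigr => i _; rewrite mxE mulrN. Qed.

Lemma linB b y z : lin b (y - z) = lin b y - lin b z.
Proof. by rewrite linD linN. Qed.

Lemma linZ b t z : lin b (t *: z) = t * lin b z.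
Proof. by rewrite mulr_sumr; apply: eq_bigr => i _; rewrite mxE mulrCA. Qed.

Lemma lin_delta b i : lin b (delta_mx 0 i) = b 0 i.
Proof.
rewrite /lin (bigD1 i)//= big1 ?addr0 => [|j ji]; rewrite !mxE !eqxx/=.
  by rewrite mulr1.
by rewrite (negbTE ji) mulr0.
Qed.

Lemma shift_continuous y : continuous (fun z => y + z).
Proof.
by move=> x; apply: (@continuousD _ _ _ (fun=> y) id);
  [exact: cst_continuous|exact: cvg_id].
Qed.

Lemma lin_continuous b : continuous (lin b).
Proof.
apply: continuous_big => [|i _ x]; first exact: add_continuous.
apply: (@continuousM _ _ (fun=> b 0 i) (fun z : 'rV[R]_d => z 0 i)).
  exact: cst_continuous.
exact: coord_continuous.
Qed.

Lemma supnorm_le_le r s z : r <= s -> supnorm_le r z -> supnorm_le s z.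
Proof. by move=> rs rz i; apply: le_trans rs. Qed.

Lemma supnorm_leD r s y z : supnorm_le r y -> supnorm_le s z -> supnorm_le (r + s) (y + z).
Proof.
by move=> ry sz i; rewrite mxE; apply: le_trans (ler_normD _ _) (lerD _ _).
Qed.

Lemma supnorm_leZ t r z : supnorm_le r z -> supnorm_le (`|t| * r) (t *: z).
Proof. by move=> rz i; rewrite mxE normrM ler_wpM2l. Qed.

Lemma supnorm_le0 r : 0 <= r -> supnorm_le r 0.
Proof. by move=> r0 i; rewrite mxE normr0. Qed.

Lemma lin_supnorm_le (b z : 'rV[R]_d) (r t : R) : (forall i, `|b 0 i| <= t) -> 0 <= t ->
  supnorm_le r z -> `|lin b z| <= d%:R * (t * r).
Proof.
move=> bt t0 rz; rewrite /lin; apply: (le_trans (ler_norm_sum _ _ _)).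
apply: (@le_trans _ _ (\sum_(i < d) t * r)).
  by apply: ler_sum => i _; rewrite normrM ler_pM.
by rewrite sumr_const card_ord -[leLHS]mulr_natl.
Qed.

Lemma enorm_supnorm_le r z : 0 <= r -> supnorm_le r z -> enorm z <= d%:R * r.
Proof.
move=> r0 rz; rewrite -[leRHS]ger0_norm ?mulr_ge0// -sqrtr_sqr.
rewrite ler_wsqrtr// (@le_trans _ _ (\sum_(i < d) r ^+ 2))//.
  apply: ler_sum => i _; rewrite -[leLHS]real_normK ?num_real//.
  by rewrite lerXn2r ?nnegrE.
rewrite sumr_const card_ord -[leLHS]mulr_natl exprMn ler_wpM2r ?sqr_ge0//.
by rewrite -natrX ler_nat; case: (d) => // n; rewrite leq_pmulr.
Qed.

Lemma enorm_gt0 z : z != 0 -> 0 < enorm z.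
Proof.
move=> z0; rewrite sqrtr_gt0 lt_neqAle sumr_ge0 ?andbT; last first.
  by move=> i _; rewrite sqr_ge0.
apply: contra z0 => /eqP/esym/eqP; rewrite psumr_eq0; last first.
  by move=> i _; rewrite sqr_ge0.
move=> /allP h; apply/eqP/rowP => i; rewrite mxE.
by have := h i (mem_index_enum _); rewrite /= sqrf_eq0 => /eqP.
Qed.

Lemma holder_diff alpha u (B r : R) x z : alpha != 1 -> 0 < alpha -> 0 <= B ->
  (holder_seminorm alpha u <= B%:E)%E -> 0 <= r -> supnorm_le r z ->
  `|u (x + z) - u x| <= B * (d%:R * r) `^ alpha.
Proof.
move=> a1 a0 B0 uB r0 rz; have [->|z0] := eqVneq z 0.
  by rewrite addr0 subrr normr0 mulr_ge0// powR_ge0.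
have : (holder_quotient alpha u x z <= B).
  rewrite -lee_fin; apply: le_trans uB; apply: ereal_sup_ubound => /=.
  by exists (x, z).
rewrite /holder_quotient (negbTE a1) ler_pdivrMr ?powR_gt0 ?enorm_gt0//.
move=> h; apply: (le_trans h); rewrite ler_wpM2l// ge0_ler_powR ?nnegrE//.
- exact: ltW.
- by rewrite sqrtr_ge0.
- by rewrite mulr_ge0.
- exact: enorm_supnorm_le.
Qed.

Definition second_diff_le u (M : R) : Prop := forall x z r, 0 <= r ->
  supnorm_le r z -> `|u (x + z) + u (x - z) - 2 * u x| <= M * r.

Lemma zygmund_diff u (B : R) : 0 <= B ->
  (holder_seminorm 1 u <= B%:E)%E -> second_diff_le u (B * d%:R).
Proof.
move=> B0 uB x z r r0 rz; have [->|z0] := eqVneq z 0.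
  rewrite addr0 subr0 (_ : u x + u x - _ = 0) ?normr0 ?mulr_ge0//; ring.
have : (holder_quotient 1 u x z <= B).
  rewrite -lee_fin; apply: le_trans uB; apply: ereal_sup_ubound => /=.
  by exists (x, z).
rewrite /holder_quotient eqxx ler_pdivrMr ?enorm_gt0// -mulrA => h.
by apply: (le_trans h); rewrite ler_wpM2l// enorm_supnorm_le.
Qed.

(** The two pairs of opposite vertices of a parallelogram have the same
midpoint. *)
Lemma mixed_diff_le w M y z r : second_diff_le w M -> 0 <= r ->
  supnorm_le r y -> supnorm_le r z -> `|w (y + z) - w y - w z + w 0| <= 2 * M * r.
Proof.
move=> wM r0 ry rz; pose c := 2^-1 *: (y + z).
have h1 : supnorm_le r c.
  move=> i; rewrite !mxE; have := ry i; have := rz i; rewrite !ler_norml; lra.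
have h2 : supnorm_le r (2^-1 *: (y - z)).
  move=> i; rewrite !mxE; have := ry i; have := rz i; rewrite !ler_norml; lra.
have := wM c _ r r0 h1; have := wM c _ r r0 h2.
have -> : c + c = y + z by apply/rowP => i; rewrite !mxE; lra.
have -> : c - c = 0 by rewrite subrr.
have -> : c + 2^-1 *: (y - z) = y by apply/rowP => i; rewrite !mxE; lra.
have -> : c - 2^-1 *: (y - z) = z by apply/rowP => i; rewrite !mxE; lra.
rewrite !ler_norml; lra.
Qed.

(** At a point where [|g|] is maximal, the second difference that reaches the
nearest end point leaves at most half of the maximum. *)
Lemma zygmund_interval (g : R -> R) (M r : R) : 0 <= M -> 0 < r ->
  continuous g -> g 0 = 0 -> g r = 0 ->
  (forall t s : R, 0 <= s -> `|g (t + s) + g (t - s) - 2 * g t| <= M * s) ->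
  forall t, `|t| <= r -> `|g t| <= 2 * M * r.
Proof.
move=> M0 r0 gc g0 gr gM.
have gle (t : R) : 0 <= t <= r -> `|g t| <= M * r.
  have [||c c0r gmax] := @EVT_max R (fun t => `|g t|) 0 r.
  - exact: ltW.
  - apply: continuous_subspaceT => s.
    exact: (continuous_comp (gc s) (@norm_continuous _ _ _)).
  move: c0r; rewrite in_itv/= => c0r tr.
  apply: (le_trans (gmax t _)); first by rewrite in_itv.
  have cM (s : R) : 0 <= s <= r -> `|g s| <= `|g c|.
    by move=> sr; apply: gmax; rewrite in_itv.
  have tri (A B E a1 a2 : R) : `|A + B - 2 * g c| <= E -> `|A| <= a1 ->
      `|B| <= a2 -> 2 * `|g c| <= E + a1 + a2.
    by case: (ger0P (g c)) => ?; rewrite !ler_norml; lra.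
  have Mr0 : 0 <= M * r by rewrite mulr_ge0// ltW.
  have [c2|c2] := lerP c (r / 2).
    have h : M * c <= M * (r / 2) by rewrite ler_wpM2l.
    have := tri _ _ _ `|g c| 0 (gM c c (andP c0r).1).
    rewrite subrr g0 normr0 lexx cM; last by lra.
    by move=> /(_ isT isT); lra.
  have h : M * (r - c) <= M * (r / 2) by rewrite ler_wpM2l//; lra.
  have rc0 : 0 <= r - c by lra.
  have := tri _ _ _ 0 `|g c| (gM c (r - c) rc0).
  rewrite (_ : c + (r - c) = r); last by ring.
  rewrite gr normr0 lexx cM; last by lra.
  by move=> /(_ isT isT); lra.
move=> t tr; have [t0|t0] := lerP 0 t.
  have := gle t; rewrite t0 -(ger0_norm t0) tr => /(_ isT); nra.
have nt0 : 0 <= - t by lra.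
have tr' : 0 <= - t <= r by rewrite nt0 -(ltr0_norm t0).
have := gle _ tr'; have := gM 0 (- t) nt0.
have : M * - t <= M * r by rewrite ler_wpM2l//; case/andP: tr'.
by rewrite g0 add0r sub0r opprK !ler_norml; lra.
Qed.

Lemma supnorm_le_axis i (t r : R) : `|t| <= r -> supnorm_le r (t *: delta_mx 0 i).
Proof.
move=> tr j; rewrite !mxE eqxx/=.
by case: (j == i); rewrite ?mulr1// mulr0 normr0 (le_trans _ tr).
Qed.

(** Changing the coordinates one after the other reduces an increment to [d]
increments along the axes, and all intermediate points stay in the cube. *)
Lemma coordinate_path w (r E : R) : 0 <= r ->
  (forall x i (t : R), `|t| <= r -> supnorm_le r x ->
    supnorm_le r (x + t *: delta_mx 0 i) ->
    `|w (x + t *: delta_mx 0 i) - w x| <= E) ->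
  forall z, supnorm_le r z -> `|w z - w 0| <= d%:R * E.
Proof.
move=> r0 wE z rz; rewrite [z](@matrix.row_sum_delta R d) -big_enum /=.
have := enum_uniq 'I_d; rewrite -[X in X%:R](size_enum_ord d).
elim: (enum 'I_d) => [_|i l IH /= /andP[il ul]].
  by rewrite big_nil subrr normr0 mul0r.
have supnorm_le_sum l' : uniq l' ->
    supnorm_le r (\sum_(j <- l') z 0 j *: delta_mx 0 j).
  move=> ul' j; rewrite summxE; have [jl|jl] := boolP (j \in l').
    rewrite (bigD1_seq j)//= big1 => [|k kj].
      by rewrite addr0 !mxE !eqxx mulr1.
    by rewrite !mxE eq_sym (negbTE kj) mulr0.
  rewrite big_seq big1 ?normr0// => k kl.
  rewrite !mxE eqxx /=; case: eqP => [jk|]; last by rewrite mulr0.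
  by rewrite jk kl in jl.
have := supnorm_le_sum (i :: l); rewrite /= il ul big_cons addrC => /(_ isT) rl.
have := wE _ _ _ (rz i) (supnorm_le_sum l ul) rl; have := IH ul.
move: (w _) (w _) (w 0) => A B D.
by rewrite -natr1 !ler_norml; lra.
Qed.

(** A Zygmund function that vanishes at the origin and at the points
[r *: e_i] is bounded on the axes, hence, by mixed differences, everywhere. *)
Lemma zygmund_bounded w M r : 0 <= M -> 0 < r -> continuous w ->
  second_diff_le w M -> w 0 = 0 -> (forall i, w (r *: delta_mx 0 i) = 0) ->
  forall z, supnorm_le r z -> `|w z| <= 4 * d%:R * M * r.
Proof.
move=> M0 r0 wc wM w0 wr z rz.
have axis i (t : R) : `|t| <= r -> `|w (t *: delta_mx 0 i)| <= 2 * M * r.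
  apply: (zygmund_interval (g := fun t => w (t *: delta_mx 0 i)) M0 r0).
  - move=> s; apply: (@continuous_comp _ _ _ (fun t : R => t *: delta_mx 0 i) w);
      last exact: wc.
    exact: scalel_continuous.
  - by rewrite scale0r.
  - exact: wr.
  - move=> {}t s s0; rewrite scalerDl scalerBl; apply: wM => //.
    by apply: supnorm_le_axis; rewrite ger0_norm.
have := coordinate_path (w := w) (E := 4 * M * r) (ltW r0) _ rz.
rewrite w0 subr0 (_ : 4 * d%:R * M * r = d%:R * (4 * M * r)); last by ring.
apply=> x i t tr rx _.
have := mixed_diff_le wM (ltW r0) rx (supnorm_le_axis i tr); have := axis i _ tr.
by rewrite w0 !ler_norml; lra.
Qed.

(** Doubling: the increment along [z] differs from half of the increment along
[2 *: z] by at most [M * `|z| / 2], so that a bound by [Num.sqrt (rho * `|z|)],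
which loses only a factor [Num.sqrt 2] at each step, follows from the trivial
bound at the scale [rho].  The exponent 1/2 could be any exponent less
than 1. *)
Lemma zygmund_holder w M rho : 0 <= M -> 0 < rho -> (0 < d)%N ->
  second_diff_le w M ->
  (forall z, supnorm_le (3 * rho) z -> `|w z| <= 12 * d%:R * M * rho) ->
  forall p q s, 0 <= s -> supnorm_le rho p -> supnorm_le rho q -> supnorm_le s (p - q) ->
  `|w p - w q| <= 48 * d%:R * M * Num.sqrt (rho * s).
Proof.
move=> M0 rho0 d0 wM wb p q s s0 rp rq sz.
have d1 : 1 <= d%:R :> R by rewrite ler1n.
have dM0 : 0 <= d%:R * M by rewrite mulr_ge0.
have supnorm_le3 z : supnorm_le rho z -> supnorm_le (3 * rho) z by apply: supnorm_le_le; lra.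
have far (t : R) z : rho <= 2 * t -> supnorm_le rho z ->
    `|w (q + z) - w q| <= 48 * d%:R * M * Num.sqrt (rho * t).
  move=> rt rz; apply: (@le_trans _ _ (24 * d%:R * M * rho)).
    have := wb _ (supnorm_le3 _ rq); have := wb (q + z).
    move=> /(_ _)/wrap[|].
      by apply: (supnorm_le_le _ (supnorm_leD rq rz)); lra.
    by rewrite !ler_norml; lra.
  have : rho <= 2 * Num.sqrt (rho * t).
    rewrite -(ler_pXn2r (n := 2)) ?nnegrE ?(ltW rho0) ?mulr_ge0 ?sqrtr_ge0//.
    rewrite exprMn sqr_sqrtr; last by nra.
    nra.
  by nra.
have near n : forall (t : R) z, supnorm_le t z -> 0 <= t <= rho -> rho <= 2 ^+ n * t ->
    `|w (q + z) - w q| <= 48 * d%:R * M * Num.sqrt (rho * t).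
  elim: n => [|n IH] t z tz /andP[t0 tr] rt.
    by apply: far (supnorm_le_le tr tz); lra.
  have [rt2|rt2] := lerP rho (2 * t); first exact: far (supnorm_le_le tr tz).
  have tz2 : supnorm_le (2 * t) (2 *: z).
    by have := supnorm_leZ 2 tz; rewrite ger0_norm.
  have := IH _ _ tz2; rewrite mulr_ge0// (ltW rt2) mulrA -exprSr => /(_ isT rt).
  have := wM (q + z) z t t0 tz.
  rewrite (_ : q + z + z = q + 2 *: z); last by apply/rowP => i; rewrite !mxE; lra.
  rewrite addrK mulrCA sqrtrM//.
  have : Num.sqrt 2 <= 3 / 2 :> R.
    rewrite -(ler_pXn2r (n := 2)) ?nnegrE ?sqrtr_ge0//.
    by rewrite sqr_sqrtr// expr2; lra.
  have : t <= Num.sqrt (rho * t).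
    rewrite -(ler_pXn2r (n := 2)) ?nnegrE ?sqrtr_ge0//.
    by rewrite sqr_sqrtr; nra.
  move: (Num.sqrt (rho * t)) (Num.sqrt 2) => X Y tX Y2 h1 h2.
  have h3 : 48 * d%:R * M * (Y * X) <= 72 * (d%:R * M) * X.
    have X0 : 0 <= X by lra.
    have : Y * X <= 3 / 2 * X by rewrite ler_wpM2r.
    by nra.
  have h4 : M * t <= d%:R * M * X.
    have MX : M * t <= M * X by rewrite ler_wpM2l.
    by rewrite -mulrA (le_trans MX)// ler_peMl// mulr_ge0//; lra.
  have h5 : 0 <= d%:R * M * X by rewrite mulr_ge0//; lra.
  by move: h1 h2; rewrite !ler_norml; lra.
have pE : q + (p - q) = p by rewrite addrC subrK.
have [s_eq0|s_neq0] := eqVneq s 0.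
  have pq0 : p - q = 0.
    apply/rowP => i; have := sz i; rewrite s_eq0 normr_le0 => /eqP->.
    by rewrite mxE.
  by rewrite -pE pq0 addr0 subrr normr0 mulr_ge0 ?mulr_ge0 ?sqrtr_ge0.
have s_gt0 : 0 < s by rewrite lt_neqAle eq_sym s_neq0.
have [sr|sr] := lerP s rho; last first.
  have := wb _ (supnorm_le3 _ rp); have := wb _ (supnorm_le3 _ rq).
  have : rho <= Num.sqrt (rho * s).
    rewrite -(ler_pXn2r (n := 2)) ?nnegrE ?sqrtr_ge0 ?(ltW rho0)//.
    by rewrite sqr_sqrtr; nra.
  by rewrite !ler_norml; nra.
rewrite -pE; apply: (near (Num.truncn (rho / s)).+1) => //; first by rewrite s0.
rewrite -ler_pdivrMr//; apply: (le_trans (ltW (truncnS_gt _))).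
by rewrite -natrX ler_nat ltnW// ltn_expl.
Qed.

(** For [alpha < 1] this is the Hoelder condition, with [beta = alpha] and
[b = 0].  Functions of the Zygmund class need not be Lipschitz, and [beta] is
[1/2] for them.  The affine function then interpolates [u] at the points [y] and
[y + 3 * rho *: e_i]. *)
Lemma holder_approx (alpha : R) : (0 < d)%N -> 0 < alpha <= 1 ->
  exists beta C : R, [/\ 0 < beta, beta <= alpha, beta < 1, 0 < C &
  forall u (B : R), 0 <= B -> holder alpha u ->
    (holder_seminorm alpha u <= B%:E)%E ->
  forall y (rho : R), 0 < rho ->
  exists2 b, (alpha != 1 -> b = 0) &
  forall p q (s : R), 0 <= s -> supnorm_le rho (p - y) -> supnorm_le rho (q - y) ->
    supnorm_le s (p - q) ->
    `|(u p - lin b p) - (u q - lin b q)| <=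
      C * B * rho `^ (alpha - beta) * s `^ beta].
Proof.
move=> d0 /andP[a0 a1]; have d0R : (0 : R) < d%:R by rewrite ltr0n.
have [aE|aN] := eqVneq alpha 1; last first.
  exists alpha, (d%:R `^ alpha); split=> //.
  - by rewrite lt_neqAle aN.
  - by rewrite powR_gt0.
  move=> u B B0 _ uB y rho rho0; exists 0 => // p q s s0 _ _ sz.
  have := holder_diff q aN a0 B0 uB s0 sz; rewrite (addrC q) subrK.
  rewrite powRM ?(ltW d0R)// !lin0 !subr0 subrr powRr0 mulr1.
  by rewrite [_ * B]mulrC -mulrA.
exists 2^-1, (48 * d%:R * d%:R); split=> //; rewrite ?aE; try lra.
  by rewrite !mulr_gt0.
move=> u B B0 [uc _] uB y rho rho0; pose r := 3 * rho.
have r0 : 0 < r by rewrite mulr_gt0.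
pose b : 'rV[R]_d := \row_i ((u (y + r *: delta_mx 0 i) - u y) / r).
exists b => [/eqP//|p q s s0 rp rq sz].
pose w z := u (y + z) - u y - lin b z.
have uM := zygmund_diff B0 uB; set M := B * d%:R in uM.
have M0 : 0 <= M by rewrite mulr_ge0.
have wM : second_diff_le w M.
  move=> x z t t0 tz; have := uM (y + x) z t t0 tz; rewrite /w !linD linN !addrA.
  by rewrite !ler_norml; lra.
have wc : continuous w.
  move=> x; apply: (@continuousB _ _ _ (fun z => u (y + z) - u y) (lin b));
    last exact: lin_continuous.
  apply: (@continuousB _ _ _ (fun z => u (y + z)) (fun=> u y));
    last exact: cst_continuous.
  by apply: (@continuous_comp _ _ _ (fun z : 'rV[R]_d => y + z) u);
    [exact: shift_continuous|exact: uc].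
have w0 : w 0 = 0.
  by rewrite /w addr0 subrr linr0 subrr.
have wr i : w (r *: delta_mx 0 i) = 0.
  by rewrite /w linZ lin_delta mxE mulrCA mulfV ?mulr1 ?subrr// gt_eqF.
have wb z : supnorm_le r z -> `|w z| <= 12 * d%:R * M * rho.
  move=> /(zygmund_bounded M0 r0 wc wM w0 wr) /le_trans; apply.
  by rewrite /r; lra.
have := zygmund_holder M0 rho0 d0 wM wb s0 rp rq.
rewrite opprB addrA subrK => /(_ sz); rewrite /w !(addrC y) !subrK !linB.
rewrite (_ : 48 * d%:R * d%:R * B * _ * _ = 48 * d%:R * M * Num.sqrt (rho * s)).
  by rewrite !ler_norml; lra.
rewrite sqrtrM ?(ltW rho0)// -!powR12_sqrt ?(ltW rho0)//.
rewrite (_ : 1 - 2^-1 = 2^-1) /M; [ring|lra].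
Qed.

End Regularity.

(** * Means over grids *)

Section Averages.
Context {R : realType} {d : nat}.
Implicit Types (g h v : 'rV[R]_d -> R) (x y z p q b : 'rV[R]_d).
Implicit Types (a : {ffun 'I_d -> bool}).

(** For [phi = bits], [grid_mean phi M eta g] is the mean of [g] over the grid
of the points [eta *: n] with [n] in [{0, ..., 2 ^ M - 1}^d].  The definition
peels off the last binary digit of the coordinates of [n].  Other functions
[phi] of the digits give the means over the faces of the grid. *)
Definition digit_mean (phi : {ffun 'I_d -> bool} -> 'rV[R]_d) (eta : R) g q : R :=
  2^-1 ^+ d * \sum_a g (q + eta *: phi a).

Fixpoint grid_mean phi (M : nat) (eta : R) g : R :=
  if M is M'.+1 then grid_mean phi M' (2 * eta) (digit_mean phi eta g) else g 0.

Definition face_bits (i : 'I_d) a : 'rV[R]_d :=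
  \row_j (if j == i then 0 else (a j)%:R).

Lemma eq_grid_mean phi M eta g h : g =1 h ->
  grid_mean phi M eta g = grid_mean phi M eta h.
Proof. by move=> /funext ->. Qed.

Lemma grid_mean_comb phi M eta : exists s : seq (R * 'rV[R]_d),
  forall g, grid_mean phi M eta g = \sum_(c <- s) c.1 * g c.2.
Proof.
elim: M eta => [|M IH] eta /=.
  by exists [:: (1, 0)] => g; rewrite big_seq1 mul1r.
have [s sE] := IH (2 * eta).
exists [seq (c.1 * 2^-1 ^+ d, c.2 + eta *: phi a) | c <- s, a <- index_enum _].
move=> g; rewrite sE big_allpairs_dep /=; apply: eq_bigr => c _.
by rewrite /digit_mean mulrA mulr_sumr.
Qed.

Lemma grid_mean_sum phi M eta (I : Type) (r : seq I) (G : I -> 'rV[R]_d -> R) :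
  grid_mean phi M eta (fun q => \sum_(i <- r) G i q) =
  \sum_(i <- r) grid_mean phi M eta (G i).
Proof.
have [s sE] := grid_mean_comb phi M eta.
rewrite sE; under [RHS]eq_bigr do rewrite sE.
by rewrite exchange_big /=; apply: eq_bigr => c _; rewrite mulr_sumr.
Qed.

Lemma grid_meanZ phi M eta t g :
  grid_mean phi M eta (fun q => t * g q) = t * grid_mean phi M eta g.
Proof.
have [s sE] := grid_mean_comb phi M eta.
by rewrite !sE mulr_sumr; apply: eq_bigr => c _; rewrite mulrCA.
Qed.

Lemma grid_meanB phi M eta g h :
  grid_mean phi M eta (fun q => g q - h q) =
  grid_mean phi M eta g - grid_mean phi M eta h.
Proof.
have [s sE] := grid_mean_comb phi M eta.
by rewrite !sE -sumrB; apply: eq_bigr => c _; rewrite mulrBr.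
Qed.

Definition unit_digits (phi : {ffun 'I_d -> bool} -> 'rV[R]_d) : Prop :=
  forall a i, 0 <= phi a 0 i <= 1.

Lemma unit_digits_bits : unit_digits (@bits R d).
Proof. by move=> a i; rewrite mxE; case: (a i) => /=; lra. Qed.

Lemma unit_digits_face i : unit_digits (face_bits i).
Proof. by move=> a j; rewrite mxE; case: (j == i); case: (a j) => /=; lra. Qed.

Lemma digit_mean_cst phi eta t q : digit_mean phi eta (fun=> t) q = t.
Proof.
rewrite /digit_mean sumr_const card_bits -[X in _ * X]mulr_natl natrX mulrA exprVn.
by rewrite mulVf ?mul1r// expf_neq0.
Qed.

Lemma grid_mean_cst phi M eta t : grid_mean phi M eta (fun=> t) = t.
Proof.
elim: M eta => //= M IH eta; rewrite -[RHS](IH (2 * eta)).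
by apply: eq_grid_mean => q; rewrite digit_mean_cst.
Qed.

Lemma le_grid_mean phi M eta g h : unit_digits phi -> 0 <= eta ->
  (forall q, cube ((2 ^+ M - 1) * eta) 0 q -> g q <= h q) ->
  grid_mean phi M eta g <= grid_mean phi M eta h.
Proof.
move=> phi01; elim: M eta g h => [|M IH] eta g h eta0 gh.
  by apply: gh; apply/cubeP => i; rewrite !mxE expr0 subrr mul0r addr0 lexx.
apply: IH => [|q /cubeP qc]; first by rewrite mulr_ge0.
rewrite ler_wpM2l ?exprn_ge0//; apply: ler_sum => a _; apply: gh.
apply/cubeP => i; have := qc i; have := phi01 a i.
rewrite !mxE exprS; move: (2 ^+ M) => X; set y := phi a 0 i.
move=> /andP[y0 y1] /andP[q0 q1].
have : eta * y <= eta by rewrite ler_piMr.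
have : 0 <= eta * y by rewrite mulr_ge0.
by lra.
Qed.

Lemma grid_mean_norm_le phi M eta g t : unit_digits phi -> 0 <= eta ->
  (forall q, cube ((2 ^+ M - 1) * eta) 0 q -> `|g q| <= t) ->
  `|grid_mean phi M eta g| <= t.
Proof.
move=> phi01 eta0 gt; rewrite ler_norml.
rewrite -[X in X <= _ <= _](grid_mean_cst phi M eta (- t)).
rewrite -[X in _ <= _ <= X](grid_mean_cst phi M eta t).
by apply/andP; split; apply: le_grid_mean => // q /gt; rewrite ler_norml => /andP[].
Qed.

(** Peeling off the first digit instead: the mean over a cube is the mean of the
means over its children. *)
Lemma grid_mean_split M eta g :
  grid_mean (@bits R d) M.+1 eta g =
  2^-1 ^+ d * \sum_a grid_mean (@bits R d) M eta
    (fun q => g (2 ^+ M * eta *: bits a + q)).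
Proof.
elim: M eta g => [|M IH] eta g /=.
  congr (_ * _); apply: eq_bigr => a _.
  by rewrite add0r addr0 expr0 mul1r.
have := IH (2 * eta) (digit_mean (@bits R d) eta g) => /= ->.
congr (_ * _); apply: eq_bigr => a _; apply: eq_grid_mean => q.
rewrite /digit_mean; congr (_ * _); apply: eq_bigr => a' _.
by rewrite exprSr -!mulrA addrA.
Qed.

Lemma grid_mean_split_at M eta l g y : 2 ^+ M * eta = l ->
  grid_mean (@bits R d) M.+1 eta (fun q => g (y + q)) =
  2^-1 ^+ d * \sum_a grid_mean (@bits R d) M eta
    (fun q => g (y + l *: bits a + q)).
Proof.
move=> <-; rewrite grid_mean_split; congr (_ * _); apply: eq_bigr => a _.
by apply: eq_grid_mean => q; rewrite addrA.
Qed.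

Definition flip (i : 'I_d) a : {ffun 'I_d -> bool} :=
  [ffun j => if j == i then ~~ a j else a j].

Lemma flipK i : involutive (flip i).
Proof. by move=> a; apply/ffunP => j; rewrite !ffunE; case: eqP; rewrite ?negbK. Qed.

(** Along the [i]-th direction the terms of the mean telescope, and only the
two opposite faces remain. *)
Lemma grid_mean_telescope i M eta g :
  grid_mean (@bits R d) M eta (fun q => g (q + eta *: delta_mx 0 i) - g q) =
  2^-1 ^+ M * grid_mean (face_bits i) M eta
    (fun q => g (q + (2 ^+ M * eta) *: delta_mx 0 i) - g q).
Proof.
elim: M eta g => [|M IH] eta g /=; first by rewrite expr0 !mul1r.
pose G := digit_mean (face_bits i) eta g.
have -> : digit_mean (@bits R d) eta (fun q => g (q + eta *: delta_mx 0 i) - g q)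
    = (fun q => 2^-1 * (G (q + 2 * eta *: delta_mx 0 i) - G q)).
  apply/funext => q; rewrite /G /digit_mean -mulrBr -sumrB mulrCA; congr (_ * _).
  set F := fun a => g (q + eta *: bits a + eta *: delta_mx 0 i) - g (q + eta *: bits a).
  have -> : \sum_a F a = 2^-1 * \sum_a (F a + F (flip i a)).
    have -> : \sum_a (F a + F (flip i a)) = \sum_a F a + \sum_a F (flip i a).
      exact: big_split.
    rewrite -[X in _ + X](reindex_inj (P := xpredT) (F := F) (inv_inj (flipK i))).
    by move: (\sum_a F a) => X; lra.
  congr (_ * _); apply: eq_bigr => a _; rewrite /F.
  have ai (a1 : {ffun 'I_d -> bool}) : bits a1 = face_bits i a1 + (a1 i)%:R *: delta_mx 0 i :> 'rV[R]_d.
    apply/rowP => j; rewrite !mxE eqxx /=; case: eqP => [->|_] /=.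
      by rewrite mulr1 add0r.
    by rewrite mulr0 addr0.
  have fi : face_bits i (flip i a) = face_bits i a.
    by apply/rowP => j; rewrite !mxE ffunE; case: eqP.
  rewrite !ai fi ffunE eqxx; set f := face_bits i a; set e := delta_mx 0 i.
  have -> : q + 2 * eta *: e + eta *: f = q + eta *: (f + e) + eta *: e.
    by apply/rowP => j; rewrite !mxE; ring.
  have fe : q + eta *: f + eta *: e = q + eta *: (f + e).
    by rewrite scalerDr addrA.
  by case: (a i) => /=; rewrite ?scale0r ?scale1r ?addr0 fe; ring.
rewrite grid_meanZ (IH (2 * eta) G) [LHS]mulrA -exprS; congr (_ * _).
apply: eq_grid_mean => q; rewrite /G /digit_mean -mulrBr -sumrB; congr (_ * _).
by apply: eq_bigr => a _; rewrite exprSr -!mulrA addrAC.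
Qed.

(** Let [l = 2 ^+ M * eta] be the side of the cube.  A translation by one grid
step [eta] along the [i]-th axis changes the mean by [eta / l] times the
difference [V i] of the means over two opposite faces.  Replacing [V i z] by
[V i 0] makes this change linear in the translation, at the cost of the modulus
of continuity of [v]: altogether an error [(r / l) * r `^ beta] for a
translation by [r].  The term in [eta] is due to rounding to multiples
of [eta]. *)
Lemma grid_mean_affine_approx v (K beta rho : R) M (eta r : R) :
  0 < beta -> beta <= 1 -> 0 <= K -> 0 < eta -> 0 <= r ->
  3 * (2 ^+ M * eta) + r <= rho ->
  (forall p q (s : R), 0 <= s -> supnorm_le rho p -> supnorm_le rho q ->
    supnorm_le s (p - q) -> `|v p - v q| <= K * s `^ beta) ->
  exists2 b : 'rV[R]_d, (forall i, `|b 0 i| <= K * (2 ^+ M * eta) `^ beta / (2 ^+ M * eta)) &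
  forall z, supnorm_le r z ->
    `|grid_mean (@bits R d) M eta (fun q => v (q + z)) -
      grid_mean (@bits R d) M eta v - lin b z| <=
    d%:R * (2 * K * (r / (2 ^+ M * eta)) * r `^ beta + 2 * K * eta `^ beta).
Proof.
move=> beta0 beta1 K0 eta0 r0; set l := 2 ^+ M * eta => lrho vH.
have l0 : 0 < l by rewrite mulr_gt0// exprn_gt0.
pose U z := grid_mean (@bits R d) M eta (fun q => v (q + z)).
pose V i z := grid_mean (face_bits i) M eta
  (fun q => v (q + l *: delta_mx 0 i + z) - v (q + z)).
have UV i z : U (z + eta *: delta_mx 0 i) - U z = 2^-1 ^+ M * V i z.
  rewrite /U /V -(grid_mean_telescope i M eta (fun q => v (q + z))) -grid_meanB.
  by apply: eq_grid_mean => q; rewrite addrA (addrAC q).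
have qin q : cube ((2 ^+ M - 1) * eta) 0 q -> supnorm_le l q.
  move=> /cubeP qc i; have := qc i; rewrite mxE /l.
  by move=> /andP[q0 q1]; rewrite ger0_norm//; lra.
have lin_ i : supnorm_le l (l *: delta_mx 0 i : 'rV[R]_d).
  by apply: supnorm_le_axis; rewrite ger0_norm// ltW.
have r_rho q : supnorm_le (l + l + r) q -> supnorm_le rho q.
  by apply: supnorm_le_le; lra.
have in1 q z : supnorm_le l q -> supnorm_le r z -> supnorm_le rho (q + z).
  by move=> lq rz; apply: r_rho; apply: supnorm_le_le (supnorm_leD lq rz); lra.
have in2 i q z : supnorm_le l q -> supnorm_le r z ->
    supnorm_le rho (q + l *: delta_mx 0 i + z).
  by move=> lq rz; apply: r_rho; exact: supnorm_leD (supnorm_leD lq (lin_ i)) rz.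
have r00 : supnorm_le r (0 : 'rV[R]_d) by exact: supnorm_le0.
have VV i z : supnorm_le r z -> `|V i z - V i 0| <= 2 * K * r `^ beta.
  move=> rz; rewrite /V -grid_meanB; apply: grid_mean_norm_le; first exact: unit_digits_face.
    exact: ltW.
  move=> q /qin lq.
  have h1 := vH _ _ r r0 (in2 i q z lq rz) (in2 i q 0 lq r00).
  have h2 := vH _ _ r r0 (in1 q z lq rz) (in1 q 0 lq r00).
  move: h1 h2; rewrite !addr0 !(addrC _ z) !addrK => /(_ rz) h1 /(_ rz) h2.
  by move: h1 h2; rewrite !ler_norml; lra.
have V0 i : `|V i 0| <= K * l `^ beta.
  apply: grid_mean_norm_le; [exact: unit_digits_face|exact: ltW|].
  move=> q /qin lq; apply: vH (ltW l0) (in2 i q 0 lq r00) (in1 q 0 lq r00) _.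
  by rewrite !addr0 addrC addKr.
pose b : 'rV[R]_d := \row_i (V i 0 / l).
have bl i : `|b 0 i| <= K * l `^ beta / l.
  by rewrite mxE normrM (gtr0_norm (_ : 0 < l^-1)) ?invr_gt0// ler_pM2r ?invr_gt0.
exists b => // z rz.
pose D z := U z - lin b z.
have -> : grid_mean (@bits R d) M eta v = U 0.
  by apply: eq_grid_mean => q; rewrite addr0.
rewrite -/(U z) (_ : U z - U 0 - lin b z = D z - D 0); last first.
  by rewrite /D linr0; ring.
apply: coordinate_path rz => // {}z i t tr rz rzt.
set e := delta_mx 0 i in rzt *.
have etal : eta / l = 2^-1 ^+ M.
  by rewrite /l invfM mulrCA mulfV ?mulr1 ?exprVn// gt_eqF.
set delta := eta / l * (2 * K * r `^ beta).
have delta0 : 0 <= delta.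
  by rewrite !mulr_ge0 ?powR_ge0 ?invr_ge0 ?(ltW eta0) ?(ltW l0).
have step x : supnorm_le r x -> `|D (x + eta *: e) - D x| <= delta.
  move=> rx; rewrite /D linD linZ lin_delta mxE.
  rewrite (_ : _ - _ = (U (x + eta *: e) - U x) - eta * (V i 0 / l)); last by ring.
  rewrite UV -etal (_ : _ - _ = eta / l * (V i x - V i 0)); last by ring.
  rewrite normrM (gtr0_norm (_ : 0 < eta / l)) ?divr_gt0//.
  by rewrite ler_wpM2l ?VV// ltW// divr_gt0.
have between x (t1 t2 : R) : 0 <= t1 <= t2 -> supnorm_le r x -> supnorm_le r (x + t2 *: e) ->
    supnorm_le r (x + t1 *: e).
  move=> /andP[t10 t12] rx rxt j; have := rx j; have := rxt j; rewrite !mxE eqxx /=.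
  by case: (j == i); rewrite /= ?mulr1 ?mulr0 ?addr0// !ler_norml; lra.
have close x (s : R) : 0 <= s <= eta -> supnorm_le r x -> supnorm_le r (x + s *: e) ->
    `|D (x + s *: e) - D x| <= 2 * K * eta `^ beta.
  move=> /andP[s0 s1] rx rxs; rewrite /D linD linZ lin_delta.
  have hU : `|U (x + s *: e) - U x| <= K * eta `^ beta.
    rewrite /U -grid_meanB; apply: grid_mean_norm_le; first exact: unit_digits_bits.
      exact: ltW.
    move=> q /qin lq; apply: vH (ltW eta0) (in1 _ _ lq rxs) (in1 _ _ lq rx) _.
    rewrite (_ : _ - _ = s *: e); last by apply/rowP => j; rewrite !mxE; ring.
    by apply: supnorm_le_axis; rewrite ger0_norm.
  have hb : `|s * b 0 i| <= K * eta `^ beta.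
    rewrite normrM (ger0_norm s0).
    apply: (@le_trans _ _ (eta * (K * l `^ beta / l))).
      by apply: ler_pM.
    rewrite (_ : eta * _ = K * (eta / l * l `^ beta)); last by ring.
    rewrite ler_wpM2l// etal /l powRM ?exprn_ge0 ?(ltW eta0)//.
    rewrite mulrA -[leRHS]mul1r ler_wpM2r ?powR_ge0// exprVn.
    rewrite mulrC ler_pdivrMr ?exprn_gt0// mul1r.
    rewrite -[leRHS]powRr1 ?exprn_ge0//.
    by apply: ler_powR => //; rewrite exprn_ege1// ler1n.
  by move: hU hb; rewrite !ler_norml; lra.
have steps x (n : nat) : supnorm_le r x -> supnorm_le r (x + (n%:R * eta) *: e) ->
    `|D (x + (n%:R * eta) *: e) - D x| <= n%:R * delta.
  elim: n => [|n IH] rx rxn.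
    by rewrite mul0r scale0r addr0 subrr normr0 mul0r.
  have rxn' : supnorm_le r (x + (n%:R * eta) *: e).
    apply: between rx rxn; rewrite mulr_ge0 ?(ltW eta0)//=.
    by rewrite ler_wpM2r ?(ltW eta0)// ler_nat.
  have := IH rx rxn'; have := step _ rxn'.
  rewrite (_ : x + (n.+1%:R * eta) *: e = x + (n%:R * eta) *: e + eta *: e).
    by rewrite -(natr1 n) mulrDl mul1r !ler_norml; lra.
  by rewrite -addrA -scalerDl -(natr1 n) mulrDl mul1r.
have forward x (s : R) : 0 <= s <= r -> supnorm_le r x -> supnorm_le r (x + s *: e) ->
    `|D (x + s *: e) - D x| <=
      2 * K * (r / l) * r `^ beta + 2 * K * eta `^ beta.
  move=> /andP[s0 sr] rx rxs; pose n := Num.truncn (s / eta).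
  have := truncn_itv (divr_ge0 s0 (ltW eta0)); rewrite -/n -natr1.
  rewrite ler_pdivlMr// ltr_pdivrMr// mulrDl mul1r => /andP[n1 n2].
  have rxn : supnorm_le r (x + (n%:R * eta) *: e).
    by apply: between rx rxs; rewrite n1 mulr_ge0// ltW.
  have h1 := steps _ _ rx rxn.
  have sE : x + s *: e = x + (n%:R * eta) *: e + (s - n%:R * eta) *: e.
    by rewrite -addrA -scalerDl (addrC _ (s - _)) subrK.
  have h2 := close (x + (n%:R * eta) *: e) (s - n%:R * eta).
  move: h2; rewrite -sE => /(_ _ rxn rxs)/wrap[|h2]; first by apply/andP; lra.
  have h3 : n%:R * delta <= 2 * K * (r / l) * r `^ beta.
    rewrite /delta (_ : _ * _ = n%:R * eta * (2 * K * r `^ beta / l)); last by ring.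
    rewrite (_ : _ * (r / l) * _ = r * (2 * K * r `^ beta / l)); last by ring.
    rewrite ler_wpM2r ?(le_trans n1)//.
    by rewrite !mulr_ge0 ?powR_ge0 ?invr_ge0 ?(ltW l0).
  by move: h1 h2 h3; rewrite !ler_norml; lra.
have [t0|t0] := lerP 0 t.
  by apply: forward rz rzt; rewrite t0 -(ger0_norm t0).
have zE : z = z + t *: e + (- t) *: e by rewrite scaleNr addrK.
rewrite distrC [in D z]zE; apply: forward => //; rewrite -?zE//.
by rewrite -(ltr0_norm t0) tr normr_ge0.
Qed.

End Averages.

(** * Polynomial approximation from the derivatives of order m *)

Section PolynomialApproximation.
Context {R : realType} {d : nat}.
Implicit Types (f g G P Q : 'rV[R]_d -> R) (x y z b : 'rV[R]_d).
Implicit Types (k : 'I_d -> nat) (i j : 'I_d).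

Inductive poly_fn (n : nat) : ('rV[R]_d -> R) -> Prop :=
| poly_fn0 : poly_fn n (fun=> 0)
| poly_fn_monomial c k P : (multi_order k <= n)%N -> poly_fn n P ->
    poly_fn n (fun z => c * monomial k z + P z).

Lemma poly_fnD n P Q : poly_fn n P -> poly_fn n Q ->
  poly_fn n (fun z => P z + Q z).
Proof.
move=> nP nQ; elim: nP => [|c k P' kn nP' IH].
  by rewrite (_ : (fun z => _) = Q)//; apply/funext => z; rewrite add0r.
rewrite (_ : (fun z => _) = (fun z => c * monomial k z + (P' z + Q z))).
  exact: poly_fn_monomial.
by apply/funext => z; rewrite addrA.
Qed.

Lemma poly_fn_one_monomial n c k : (multi_order k <= n)%N ->
  poly_fn n (fun z => c * monomial k z).
Proof.
move=> kn; have := poly_fn_monomial c kn (poly_fn0 n).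
by rewrite (_ : (fun z => _ + 0) = fun z => c * monomial k z)//;
  apply/funext => z; rewrite addr0.
Qed.

Lemma poly_fn_cst n c : poly_fn n (fun=> c).
Proof.
rewrite (_ : (fun=> c) = fun z => c * monomial (fun=> 0%N) z).
  by apply: poly_fn_one_monomial; rewrite /multi_order big1.
by apply/funext => z; rewrite /monomial big1 ?mulr1// => i _; rewrite expr0.
Qed.

Lemma poly_fn_affine n a b : (0 < n)%N -> poly_fn n (fun z => a + lin b z).
Proof.
move=> n0; apply: poly_fnD; first exact: poly_fn_cst.
rewrite /lin; elim: (index_enum _) => [|i l IH].
  rewrite (_ : (fun z => _) = fun=> 0); first exact: poly_fn0.
  by apply/funext => z; rewrite big_nil.
rewrite (_ : (fun z => _) = fun z => b 0 i * monomial (fun j => nat_of_bool (j == i)) z +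
  \sum_(j <- l) b 0 j * z 0 j).
  apply: poly_fn_monomial => //.
  by rewrite /multi_order (bigD1 i)//= eqxx big1// => j /negbTE ->.
apply/funext => z; rewrite big_cons /monomial (bigD1 i)//= eqxx expr1.
congr (_ + _); rewrite big1 => [|j /negbTE ji]; first by rewrite mulr1.
by rewrite ji expr0.
Qed.

Definition drop_coord i z := z - z 0 i *: delta_mx 0 i.

Lemma drop_coordE i z j :
  drop_coord i z 0 j = if j == i then 0 else z 0 j.
Proof.
rewrite !mxE eqxx /=; case: eqP => [->|_] /=; first by rewrite mulr1 subrr.
by rewrite mulr0 subr0.
Qed.

Lemma poly_fn_drop n i P : poly_fn n P -> poly_fn n (fun z => P (drop_coord i z)).
Proof.
elim=> [|c k P' kn _ IH]; first exact: poly_fn0.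
have [ki|ki] := eqVneq (k i) 0%N.
  rewrite (_ : (fun z => _) = fun z => c * monomial k z + P' (drop_coord i z)).
    exact: poly_fn_monomial.
  apply/funext => z; congr (_ * _ + _); apply: eq_bigr => j _.
  by rewrite drop_coordE; case: eqP => // ->; rewrite ki !expr0.
rewrite (_ : (fun z => _) = fun z => P' (drop_coord i z))//.
apply/funext => z; rewrite /monomial (bigD1 i)//= drop_coordE eqxx.
by rewrite expr0n (negbTE ki) mul0r mulr0 add0r.
Qed.

Lemma axis_coord x i j (t : R) :
  (x + t *: delta_mx 0 i) 0 j = x 0 j + t * (j == i)%:R.
Proof. by rewrite !mxE. Qed.

Lemma monomial_axis k i x (t : R) : x 0 i = 0 ->
  monomial k (x + t *: delta_mx 0 i) =
  t ^+ k i * \prod_(j < d | j != i) x 0 j ^+ k j.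
Proof.
move=> xi; rewrite /monomial (bigD1 i)//= !mxE !eqxx xi mulr1 add0r.
congr (_ * _); apply: eq_bigr => j ji.
by rewrite !mxE (negbTE ji) andbF mulr0 addr0.
Qed.

Lemma poly_fn_antiderivative n i P : poly_fn n P ->
  exists2 Q, poly_fn n.+1 Q & forall x, x 0 i = 0 ->
    Q x = 0 /\ forall t : R, is_derive t 1 (fun t : R => Q (x + t *: delta_mx 0 i))
                        (P (x + t *: delta_mx 0 i)).
Proof.
elim=> [|c k P' kn _ [Q' nQ' Q'P']].
  exists (fun=> 0) => [|x xi]; first exact: poly_fn0.
  by split=> // t; exact: is_derive_cst.
pose k' j := (k j + (j == i))%N.
have k'n : (multi_order k' <= n.+1)%N.
  rewrite /multi_order big_split /= -addn1 leq_add//.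
  by rewrite (bigD1 i)//= eqxx big1// => j /negbTE ->.
exists (fun z => c / (k i).+1%:R * monomial k' z + Q' z) => [|x xi].
  exact: poly_fn_monomial.
have [Q'0 Q'd] := Q'P' x xi; split.
  rewrite Q'0 addr0 /monomial (bigD1 i)//= xi /k' eqxx addn1 expr0n /=.
  by rewrite mul0r mulr0.
move=> t.
have -> : (fun t : R => c / (k i).+1%:R * monomial k' (x + t *: delta_mx 0 i) +
    Q' (x + t *: delta_mx 0 i)) =
   (fun t : R => (c / (k i).+1%:R * \prod_(j < d | j != i) x 0 j ^+ k j) * t ^+ (k i).+1 +
     Q' (x + t *: delta_mx 0 i)).
  apply/funext => s; rewrite monomial_axis// /k' eqxx addn1.
  rewrite (eq_bigr (fun j => x 0 j ^+ k j)) => [|j /negbTE->]; last by rewrite addn0.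
  by rewrite -!mulrA (mulrC (s ^+ _)).
rewrite monomial_axis//; set p := \prod_(_ < _ | _) _.
apply: (@is_deriveD _ _ _
  (fun t : R => c / (k i).+1%:R * p * t ^+ (k i).+1)
  (fun t : R => Q' (x + t *: delta_mx 0 i))).
have := is_deriveZ (c / (k i).+1%:R * p)
  (is_deriveX (k i).+1 (is_derive_id t (1 : R))).
rewrite (_ : _ \*: _ = (fun t : R => c / (k i).+1%:R * p * t ^+ (k i).+1)); last first.
  by apply/funext => s; rewrite /= exprfctE.
move=> /is_derive_eq; apply.
rewrite /GRing.scale /= mulr1 !mulrA; field.
by rewrite addrC natr1 pnatr_eq0.
Qed.

Lemma is_derive_axis G i x (t : R) :
  differentiable G (x + t *: delta_mx 0 i) ->
  is_derive t 1 (fun t : R => G (x + t *: delta_mx 0 i))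
    (partial i G (x + t *: delta_mx 0 i)).
Proof.
move=> dG; have dGi : derivable G (x + t *: delta_mx 0 i) (delta_mx 0 i).
  exact: diff_derivable.
have quotE : (fun h : R => h^-1 *: (((fun t : R => G (x + t *: delta_mx 0 i)) \o
    shift t) (h *: 1) - G (x + t *: delta_mx 0 i))) =
  (fun h : R => h^-1 *: ((G \o shift (x + t *: delta_mx 0 i)) (h *: delta_mx 0 i) -
    G (x + t *: delta_mx 0 i))).
  apply/funext => h /=; congr (_ *: (G _ - _)).
  by rewrite [h *: 1]mulr1 scalerDl addrCA.
apply: DeriveDef; first by rewrite /derivable quotE.
by rewrite /partial /derive quotE.
Qed.

Lemma derive_bound (g dg : R -> R) (E t : R) :
  (forall s : R, `|s| <= `|t| -> is_derive s (1 : R) g (dg s)) ->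
  (forall s : R, `|s| <= `|t| -> `|dg s| <= E) -> `|g t - g 0| <= E * `|t|.
Proof.
move=> gd dgE.
have gc s : `|s| <= `|t| -> {for s, continuous g}.
  move=> /gd [+ _]; move=> /derivable1_diffP; exact: differentiable_continuous.
have [t0|t0] := lerP 0 t.
  have ts s : 0 <= s <= t -> `|s| <= `|t|.
    by move=> /andP[s0 st]; rewrite !ger0_norm.
  have [||c] := @MVT_segment R g dg 0 t t0.
  - move=> s; rewrite in_itv /= => /andP[s0 st].
    by apply: gd; apply: ts; rewrite !ltW.
  - apply: continuous_in_subspaceT => s; rewrite inE /= in_itv /= => st.
    exact/gc/ts.
  rewrite in_itv /= => ct ->; rewrite subr0 normrM ler_wpM2r//.
  exact/dgE/ts.
have ts s : t <= s <= 0 -> `|s| <= `|t|.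
  by move=> /andP[s0 st]; rewrite !ler0_norm ?lerN2// ltW.
have [||c] := @MVT_segment R g dg t 0 (ltW t0).
- move=> s; rewrite in_itv /= => /andP[s0 st].
  by apply: gd; apply: ts; rewrite !ltW.
- apply: continuous_in_subspaceT => s; rewrite inE /= in_itv /= => st.
  exact/gc/ts.
rewrite in_itv /= => ct gE; rewrite distrC gE sub0r normrM normrN ler_wpM2r//.
exact/dgE/ts.
Qed.

(** [multi_partial] along a list of coordinates, for inductions on this
list. *)
Definition partials (l : seq 'I_d) k f : 'rV[R]_d -> R :=
  foldr (fun i g => iter (k i) (partial i) g) f l.

Lemma partials_rcons l i k f :
  partials (rcons l i) k f = partials l k (iter (k i) (partial i) f).
Proof. by rewrite /partials foldr_rcons. Qed.

Lemma eq_partials l k k' f : (forall i, i \in l -> k i = k' i) ->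
  partials l k f = partials l k' f.
Proof.
elim: l => //= i l IH kk'; rewrite kk' ?mem_head// IH// => j jl.
by rewrite kk'// inE jl orbT.
Qed.

Lemma partials_eq0 l k f : (forall i, i \in l -> k i = 0%N) -> partials l k f = f.
Proof.
elim: l => //= i l IH k0; rewrite k0 ?mem_head//= IH// => j jl.
by rewrite k0// inE jl orbT.
Qed.

Definition supported (l : seq 'I_d) z : Prop := forall j, j \notin l -> z 0 j = 0.

(** Taylor's theorem, by induction on the coordinates in the order in which
[multi_partial] differentiates.  If [i] is the coordinate that is differentiated first, then
[G z] is the value of [G] at the projection of [z] on the other coordinates,
where there is one coordinate less, plus the integral of [partial i G] along
the [i]-th axis, where the order is one less. *)
Lemma polynomial_approx (e : nat) (l : seq 'I_d) (m : nat) : uniq l ->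
  exists2 C : R, 0 <= C & forall G (r eps : R), 0 <= r -> 0 <= eps ->
  times_differentiable m G ->
  (forall k, (forall j, j \notin l -> k j = 0%N) -> (\sum_(j <- l) k j = m)%N ->
    exists2 P, poly_fn e P & forall z, supported l z -> supnorm_le r z ->
      `|partials l k G z - P z| <= eps) ->
  exists2 P, poly_fn (m + e) P & forall z, supported l z -> supnorm_le r z ->
    `|G z - P z| <= C * eps * r ^+ m.
Proof.
elim/last_ind: l m => [|l i IHl] m.
  move=> _; exists 1 => // G r eps r0 eps0 _; case: m => [|m] approx.
    have [|P eP GP] := approx (fun=> 0%N) (fun _ _ => erefl); first by rewrite big_nil.
    by exists P => // z zl rz; rewrite mul1r expr0 mulr1; exact: GP.
  exists (fun=> G 0) => [|z zl rz]; first exact: poly_fn_cst.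
  rewrite (_ : z = 0); first by rewrite subrr normr0 !mulr_ge0 ?exprn_ge0.
  by apply/rowP => j; rewrite mxE zl.
rewrite rcons_uniq => /andP[il ul].
elim: m => [|m [C2 C20 IHm]].
  exists 1 => // G r eps r0 eps0 _ approx.
  have [|P eP GP] := approx (fun=> 0%N) (fun _ _ => erefl); first by rewrite big1.
  exists P => // z zl rz; rewrite mul1r expr0 mulr1.
  by have := GP z zl rz; rewrite partials_eq0.
have [C1 C10 IH1] := IHl m.+1 ul.
exists (C1 + C2) => [|G r eps r0 eps0 [dG dGm] approx]; first exact: addr_ge0.
have sl z : supported l z -> supported (rcons l i) z.
  move=> zl j; rewrite mem_rcons inE negb_or => /andP[_ /zl].
  exact.
have [|k kl km|P1 nP1 GP1] := IH1 G r eps r0 eps0; first by split.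
  have ki : k i = 0%N by exact: kl.
  have [||P eP GP] := approx k.
  - by move=> j; rewrite mem_rcons inE negb_or => /andP[_ /kl].
  - by rewrite -cats1 big_cat big_seq1 /= ki addn0.
  by exists P => // z /sl zl rz; have := GP z zl rz; rewrite partials_rcons ki.
have [|k kl km|P2 nP2 GP2] := IHm (partial i G) r eps r0 eps0; first exact: dGm.
  pose k' j := (k j + (j == i))%N.
  have [||P eP GP] := approx k'.
  - move=> j jl; rewrite /k' kl// add0n; apply/eqP; rewrite eqb0.
    by apply: contra jl => /eqP->; rewrite mem_rcons mem_head.
  - rewrite big_split /= km -addn1; congr addn.
    rewrite -cats1 big_cat big_seq1 eqxx /= big_seq big1 ?add0n// => j jl.
    by apply/eqP; rewrite eqb0; apply: contra il => /eqP <-.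
  exists P => // z zl rz; have := GP z zl rz; rewrite !partials_rcons.
  rewrite /k' eqxx addn1 iterSr (@eq_partials l _ k)// => j jl.
  case: eqP => [ji|_]; last by rewrite addn0.
  by rewrite -ji jl in il.
have [Q nQ QP] := poly_fn_antiderivative i nP2.
exists (fun z => Q z + P1 (drop_coord i z)).
  by rewrite addSn; apply: poly_fnD => //; rewrite -addSn; apply: poly_fn_drop.
move=> z zl rz; pose x := drop_coord i z; set t := z 0 i.
have zE : z = x + t *: delta_mx 0 i by rewrite /x /drop_coord subrK.
have xi : x 0 i = 0 by rewrite drop_coordE eqxx.
have [Qx Qd] := QP x xi.
have rx : supnorm_le r x.
  by move=> j; rewrite drop_coordE; case: eqP; rewrite ?normr0.
have xl : supported l x.
  move=> j jl; rewrite drop_coordE; case: eqP => // /eqP ji.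
  by apply: zl; rewrite mem_rcons inE negb_or ji.
have h1 := GP1 x xl rx.
have := @derive_bound (fun t => G (x + t *: delta_mx 0 i) - Q (x + t *: delta_mx 0 i))
  (fun t => partial i G (x + t *: delta_mx 0 i) - P2 (x + t *: delta_mx 0 i))
  (C2 * eps * r ^+ m) t.
move=> /(_ _)/wrap[s st|].
  have := @is_deriveB _ _ _ (fun t : R => G (x + t *: delta_mx 0 i))
    (fun t : R => Q (x + t *: delta_mx 0 i)) _ _ _ _ (is_derive_axis (dG _)) (Qd s).
  exact.
move=> /(_ _)/wrap[s st|].
  have str : `|s| <= r := le_trans st (rz i).
  apply: GP2 => [j jl|j].
    have := zl j jl; rewrite {1}zE !axis_coord.
    case: eqP => [ji|_]; last by rewrite !mulr0.
    by move: jl; rewrite ji mem_rcons mem_head.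
  have := rx j; rewrite axis_coord.
  case: eqP => [->|_] /=; first by rewrite xi add0r mulr1.
  by rewrite mulr0 addr0.
rewrite scale0r addr0 -zE Qx subr0 => h2.
have h3 : C2 * eps * r ^+ m * `|t| <= C2 * eps * r ^+ m.+1.
  by rewrite exprSr mulrA ler_wpM2l ?rz// !mulr_ge0// exprn_ge0.
by move: h1 h2 h3; rewrite -/x !mulrDl !ler_norml; lra.
Qed.

End PolynomialApproximation.

(** * Combinations of translates *)

Section TranslateCombinations.
Context {R : realType} {d : nat}.
Implicit Types (f g G P Q : 'rV[R]_d -> R) (x y z p : 'rV[R]_d).
Implicit Types (k : 'I_d -> nat) (i j : 'I_d) (s : seq (R * 'rV[R]_d)).

(** Values, differences and means of [f] are all of this form, and so are those
of its derivatives and of its integrals. *)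
Definition comb s f z : R := \sum_(c <- s) c.1 * f (c.2 + z).

Lemma differentiable_shift f p x : differentiable f (p + x) ->
  differentiable (fun z => f (p + z)) x.
Proof.
by move=> df; apply: (@differentiable_comp _ _ _ _ (fun z => p + z) f).
Qed.

Lemma derive_shift f p v x :
  'D_v (fun z => f (p + z)) x = 'D_v f (p + x).
Proof.
have quotE : (fun h : R => h^-1 *: (((fun z => f (p + z)) \o shift x) (h *: v) -
    f (p + x))) =
  (fun h : R => h^-1 *: ((f \o shift (p + x)) (h *: v) - f (p + x))).
  by apply/funext => h /=; rewrite (addrCA p).
by rewrite /derive quotE.
Qed.

Lemma differentiable_comb s f : (forall x, differentiable f x) ->
  forall x, differentiable (comb s f) x.
Proof.
move=> df x; rewrite /comb; elim: s => [|c s IH].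
  rewrite (_ : (fun z => _) = fun=> 0); first exact: differentiable_cst.
  by apply/funext => z; rewrite big_nil.
rewrite (_ : (fun z => _) = (fun z => c.1 * f (c.2 + z)) +
    (fun z => \sum_(c <- s) c.1 * f (c.2 + z))).
  apply: differentiableD => //.
  by apply: differentiableZ; exact: differentiable_shift.
by apply/funext => z; rewrite big_cons.
Qed.

Lemma partial_comb s f i : (forall x, differentiable f x) ->
  partial i (comb s f) = comb s (partial i f).
Proof.
move=> df; apply/funext => x; rewrite /partial /comb; elim: s => [|c s IH].
  rewrite big_nil (_ : (fun z => _) = fun=> 0); first exact: derive_cst.
  by apply/funext => z; rewrite big_nil.
rewrite (_ : (fun z => _) = (c.1 \*: (fun z => f (c.2 + z))) + comb s f); last first.
  by apply/funext => z; rewrite big_cons.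
have dfc : differentiable (fun z => f (c.2 + z)) x by exact: differentiable_shift.
rewrite deriveD; first last.
- by apply: diff_derivable; exact: differentiable_comb.
- by apply: diff_derivable; exact: differentiableZ.
rewrite deriveZ; last exact: diff_derivable.
by rewrite IH derive_shift big_cons.
Qed.

Lemma times_differentiable_comb m s f : times_differentiable m f ->
  times_differentiable m (comb s f).
Proof.
elim: m f => //= m IH f [df dfm]; split; first exact: differentiable_comb.
by move=> i; rewrite partial_comb//; exact: IH.
Qed.

Lemma times_differentiable_iter m n i f : times_differentiable (n + m) f ->
  times_differentiable m (iter n (partial i) f).
Proof. by elim: n f => //= n IH f [_ dfn]; rewrite -iterS iterSr; exact: IH. Qed.

Lemma iter_partial_comb n s i f : times_differentiable n f ->
  iter n (partial i) (comb s f) = comb s (iter n (partial i) f).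
Proof.
elim: n f => // n IH f [df dfn]; rewrite !iterSr partial_comb// IH//.
exact: dfn.
Qed.

Lemma times_differentiable_le m n f : (m <= n)%N ->
  times_differentiable n f -> times_differentiable m f.
Proof.
elim: m n f => // m IH [//|n] f mn [df dfn]; split=> // i.
exact: IH (dfn i).
Qed.

Lemma partials_comb l k m s f :
  times_differentiable (\sum_(i <- l) k i + m)%N f ->
  partials l k (comb s f) = comb s (partials l k f) /\
  times_differentiable m (partials l k f).
Proof.
elim: l m => [|i l IH] m /=; first by rewrite big_nil.
rewrite big_cons addnAC => df; have [|-> dlf] := IH (k i + m)%N.
  by rewrite addnC.
split; last exact: times_differentiable_iter.
by apply: iter_partial_comb; apply: times_differentiable_le dlf; rewrite leq_addr.
Qed.

Lemma multi_partialE k f : multi_partial k f = partials (enum 'I_d) k f.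
Proof. by []. Qed.

Lemma multi_partial_comb k s f : times_differentiable (multi_order k) f ->
  multi_partial k (comb s f) = comb s (multi_partial k f).
Proof.
move=> df; rewrite !multi_partialE.
by have [|->] := @partials_comb (enum 'I_d) k 0 s f; rewrite // big_enum addn0.
Qed.

Lemma comb_polynomial_approx (e m : nat) :
  exists2 C : R, 0 <= C & forall f s (r eps : R), 0 <= r -> 0 <= eps ->
  times_differentiable m f ->
  (forall k, multi_order k = m -> exists2 P, poly_fn e P & forall z,
     supnorm_le r z -> `|comb s (multi_partial k f) z - P z| <= eps) ->
  exists2 P, poly_fn (m + e) P & forall z, supnorm_le r z ->
    `|comb s f z - P z| <= C * eps * r ^+ m.
Proof.
have [C C0 approx] := @polynomial_approx R d e (enum 'I_d) m (enum_uniq _).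
exists C => // f s r eps r0 eps0 df fP.
have [||P nP combP] := approx (comb s f) r eps r0 eps0.
- exact: times_differentiable_comb.
- move=> k _; rewrite big_enum => km; have [P eP fkP] := fP k km.
  exists P => // z _ rz; rewrite -multi_partialE multi_partial_comb ?fkP//.
  by rewrite /multi_order km.
exists P => // z rz; apply: combP => // j.
by rewrite mem_enum.
Qed.

End TranslateCombinations.

(** * Integrals of continuous functions against compactly supported measures *)

Section ContinuousFunctions.
Context {R : realType} {d : nat}.
Implicit Types (f g : 'rV[R]_d -> R) (x w : 'rV[R]_d).

Lemma continuous_bounded_compact (A : set 'rV[R]_d) g : compact A ->
  continuous g -> exists2 E : R, 0 <= E & forall w, A w -> `|g w| <= E.
Proof.
move=> cA cg; have /compact_bounded[M [_ MA]] : compact (g @` A).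
  by apply: continuous_compact => //; exact: continuous_subspaceT.
exists (`|M| + 1) => [|w Aw]; first by rewrite addr_ge0.
apply: (MA (`|M| + 1)); last by exists w.
by rewrite ltr_pwDr// ler_norm.
Qed.

Lemma norm_ball_compact (rho : R) : compact [set y : 'rV[R]_d | `|y| <= rho].
Proof.
apply: bounded_closed_compact.
  exists rho; split=> [|M rhoM y /= yrho]; first exact: num_real.
  exact: le_trans (ltW rhoM).
apply: (closed_comp (f := fun y : 'rV[R]_d => `|y|) (D := [set x | x <= rho])).
  by move=> y _; exact: norm_continuous.
exact: closed_le.
Qed.

End ContinuousFunctions.

Section ConcentratedMeasure.
Context {R : realType} {d : nat} (mu : {finite_measure set (borel_rV R d) -> \bar R}).
Context (K : set 'rV[R]_d) (cK : compact K) (muK : mu (~` K) = 0%E).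
Implicit Types (f g : 'rV[R]_d -> R) (x w : 'rV[R]_d).

Lemma measurable_continuous_rV g : continuous g ->
  measurable_fun setT (g : borel_rV R d -> R).
Proof.
move=> /continuousP cg; apply: (measurability _ (RGenOpens.measurableE R)).
move=> _ [_ [a [b ->] <-]]; rewrite setTI; apply: sub_sigma_algebra.
exact/cg/interval_open.
Qed.

Let mK : measurable (K : set (borel_rV R d)).
Proof.
rewrite -[K]setCK; apply: measurableC; apply: sub_sigma_algebra.
by rewrite openC; apply: compact_closed.
Qed.

Lemma ae_concentrated (Q : 'rV[R]_d -> Prop) : (forall w, K w -> Q w) ->
  {ae mu, forall w, Q w}.
Proof.
move=> KQ; exists (~` K); split=> //; first exact: measurableC.
by apply: subsetC => w /KQ.
Qed.

Lemma abs_integral_le g (E : R) : continuous g -> 0 <= E ->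
  (forall w, K w -> `|g w| <= E) ->
  (\int[mu]_w `|(g w)%:E| <= E%:E * mu setT)%E.
Proof.
move=> cg E0 gE; apply: integral_le_bound => //; rewrite ?lee_fin//.
  by apply/measurable_EFinP; exact: measurable_continuous_rV.
by apply: ae_concentrated => w Kw _; rewrite lee_fin gE.
Qed.

Lemma integrable_continuous g : continuous g -> mu.-integrable setT (EFin \o g).
Proof.
move=> cg; have [E E0 gE] := continuous_bounded_compact cK cg.
apply/integrableP; split.
  by apply/measurable_EFinP; exact: measurable_continuous_rV.
apply: (le_lt_trans (abs_integral_le cg E0 gE)).
by rewrite -ge0_fin_numE ?mule_ge0 ?lee_fin// fin_numM// fin_num_measure.
Qed.

Lemma norm_Rintegral_le g (E : R) : continuous g -> 0 <= E ->
  (forall w, K w -> `|g w| <= E) ->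
  `|\int[mu]_w g w| <= E * fine (mu setT).
Proof.
move=> cg E0 gE; have ig := integrable_continuous cg.
apply: (le_trans (le_normr_Rintegral _ ig)) => //.
have iE := abs_integral_le cg E0 gE.
have finE : (\int[mu]_w `|(g w)%:E|)%E \is a fin_num.
  rewrite ge0_fin_numE; first by have /integrableP[_] := ig.
  by apply: integral_ge0 => w _; rewrite abse_ge0.
rewrite -lee_fin EFinM [X in (_ <= _ * X)%E]fineK ?fin_num_measure//.
by rewrite /Rintegral (fineK finE).
Qed.

Lemma dilation_continuous x w : continuous (fun h : R => x + h *: w).
Proof.
move=> h; apply: (@continuousD _ _ _ (fun=> x) (fun h : R => h *: w)).
  exact: cst_continuous.
exact: scalel_continuous.
Qed.

Lemma homothety_continuous x (h : R) : continuous (fun w : 'rV[R]_d => x + h *: w).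
Proof.
move=> w; apply: (@continuousD _ _ _ (fun=> x) (fun w => h *: w)).
  exact: cst_continuous.
exact: scaler_continuous.
Qed.

Lemma continuous_Rintegral_dilation f x : continuous f ->
  continuous (fun h : R => \int[mu]_w f (x + h *: w)).
Proof.
move=> cf h.
have cfh t : continuous (fun w : 'rV[R]_d => f (x + t *: w)).
  move=> w; apply: (@continuous_comp _ _ _ (fun w : 'rV[R]_d => x + t *: w) f).
    exact: homothety_continuous.
  exact: cf.
have [M [_ MK]] := compact_bounded cK.
pose rho := `|x| + (`|h| + 1) * (`|M| + 1).
have [E E0 fE] := continuous_bounded_compact (@norm_ball_compact R d rho) cf.
have thE t w : h - 1 < t < h + 1 -> K w -> `|f (x + t *: w)| <= E.
  move=> ht Kw; apply: fE => /=; apply: (le_trans (ler_normD _ _)).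
  rewrite lerD2l normrZ ler_pM//.
    rewrite ler_norml; have := ler_norm h; have := ler_norm (- h).
    by rewrite normrN; lra.
  by apply: (MK (`|M| + 1)) => //; rewrite ltr_pwDr// ler_norm.
have := @continuity_under_integral R _ (borel_rV R d) mu
  (fun t w => f (x + t *: w)) setT measurableT (h - 1) (h + 1) _ _ (cst E).
apply.
- by move=> t _; exact: integrable_continuous.
- apply: aeW => w _ t _.
  by apply: (@continuous_comp _ _ _ (fun t : R => x + t *: w) f);
    [exact: dilation_continuous|exact: cf].
- exact: finite_measure_integrable_cst.
- move=> t; rewrite /= in_itv /= => ht; apply: ae_concentrated => w Kw _.
  exact: thE.
- by rewrite inE /= in_itv /=; lra.
Qed.

End ConcentratedMeasure.

Section ChargeIntegral.
Context {R : realType} {d : nat} (sigma : {charge set (borel_rV R d) -> \bar R}).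
Context (K : set 'rV[R]_d) (cK : compact K)
  (sigmaK : Defs.total_variation sigma (~` K) = 0%E).
Implicit Types (f g G P : 'rV[R]_d -> R) (x w z : 'rV[R]_d).
Implicit Types (k : 'I_d -> nat) (s : seq (R * 'rV[R]_d)).

Let posK : charge_pos sigma (~` K) = 0%E.
Proof.
have : (charge_pos sigma (~` K) + charge_neg sigma (~` K) = 0)%E by [].
by move=> /eqP; rewrite padde_eq0 ?measure_ge0// => /andP[/eqP].
Qed.

Let negK : charge_neg sigma (~` K) = 0%E.
Proof.
have : (charge_pos sigma (~` K) + charge_neg sigma (~` K) = 0)%E by [].
by move=> /eqP; rewrite padde_eq0 ?measure_ge0// => /andP[_ /eqP].
Qed.

Definition charge_mass : R :=
  fine (charge_pos sigma setT) + fine (charge_neg sigma setT).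

Lemma charge_mass_ge0 : 0 <= charge_mass.
Proof. by rewrite addr_ge0// fine_ge0// measure_ge0. Qed.

Lemma charge_integral_le g (E : R) : continuous g -> 0 <= E ->
  (forall w, K w -> `|g w| <= E) -> `|charge_integral sigma g| <= E * charge_mass.
Proof.
move=> cg E0 gE; rewrite mulrDr; apply: (le_trans (ler_normB _ _)).
by apply: lerD; [exact: (norm_Rintegral_le cK posK)|exact: (norm_Rintegral_le cK negK)].
Qed.

Lemma charge_integralD f g : continuous f -> continuous g ->
  charge_integral sigma (fun w => f w + g w) =
  charge_integral sigma f + charge_integral sigma g.
Proof.
move=> cf cg; rewrite /charge_integral.
rewrite !RintegralD//; do ?[exact: (integrable_continuous cK posK)|exact: (integrable_continuous cK negK)].
ring.
Qed.

Lemma charge_integralZ (a : R) f : continuous f ->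
  charge_integral sigma (fun w => a * f w) = a * charge_integral sigma f.
Proof.
move=> cf; rewrite /charge_integral.
rewrite !RintegralZl//; do ?[exact: (integrable_continuous cK posK)|exact: (integrable_continuous cK negK)].
by rewrite mulrBr.
Qed.

Lemma charge_integral0 : charge_integral sigma (fun=> 0) = 0.
Proof. by rewrite /charge_integral !Rintegral_cst// !mul0r subrr. Qed.

Lemma monomial_continuous k : continuous (@monomial R d k).
Proof.
apply: continuous_big => [|i _ x]; first exact: mul_continuous.
apply: (@continuous_comp _ _ _ (fun x : 'rV[R]_d => x 0 i) (fun t : R => t ^+ k i)).
  exact: coord_continuous.
exact: exprn_continuous.
Qed.

Lemma continuous_add f g : continuous f -> continuous g ->
  continuous (fun w => f w + g w).
Proof.
move=> cf cg w; apply: (@continuousD _ _ _ f g); [exact: cf|exact: cg].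
Qed.

Lemma continuous_scale (a : R) f : continuous f -> continuous (fun w => a * f w).
Proof.
move=> cf w; apply: (@continuousM _ _ (fun=> a) f); last exact: cf.
exact: cst_continuous.
Qed.

Lemma poly_fn_continuous n P : poly_fn n P -> continuous P.
Proof.
elim=> [|c k P' _ _ cP']; first exact: cst_continuous.
by apply: continuous_add => //; apply: continuous_scale; exact: monomial_continuous.
Qed.

Lemma continuous_dilate f x (h : R) : continuous f ->
  continuous (fun w : 'rV[R]_d => f (x + h *: w)).
Proof.
move=> cf w; apply: (@continuous_comp _ _ _ (fun w : 'rV[R]_d => x + h *: w) f).
  exact: homothety_continuous.
exact: cf.
Qed.

Lemma monomial_dilate k (h : R) w :
  monomial k (h *: w) = h ^+ multi_order k * monomial k w.
Proof.
rewrite /monomial /multi_order -prodrXr -big_split /=; apply: eq_bigr => i _.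
by rewrite mxE exprMn.
Qed.

Lemma charge_integral_poly n P (h : R) :
  (forall k, (multi_order k <= n)%N -> charge_integral sigma (monomial k) = 0) ->
  poly_fn n P -> charge_integral sigma (fun w => P (h *: w)) = 0.
Proof.
move=> moments; elim=> [|c k P' kn nP' IH]; first exact: charge_integral0.
have cP' := poly_fn_continuous nP'.
have -> : (fun w => c * monomial k (h *: w) + P' (h *: w)) =
    (fun w => (c * h ^+ multi_order k) * monomial k w + P' (0 + h *: w)).
  by apply/funext => w; rewrite monomial_dilate add0r mulrA.
rewrite charge_integralD; last exact: continuous_dilate.
  rewrite charge_integralZ ?moments//; last exact: monomial_continuous.
  by rewrite mulr0 add0r -IH; under eq_fun do rewrite add0r.
by apply: continuous_scale; exact: monomial_continuous.
Qed.

Lemma comb_continuous s f : continuous f -> continuous (comb s f).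
Proof.
move=> cf; rewrite /comb; apply: continuous_big => [|c _].
  exact: add_continuous.
apply: continuous_scale => w.
apply: (@continuous_comp _ _ _ (fun w : 'rV[R]_d => c.2 + w) f); last exact: cf.
exact: shift_continuous.
Qed.

Lemma comb_Delta s f (h : R) : continuous f ->
  \sum_(c <- s) c.1 * Delta sigma f c.2 h =
  charge_integral sigma (fun w => comb s f (0 + h *: w)).
Proof.
move=> cf; rewrite /comb; elim: s => [|c s IH].
  under [in RHS]eq_fun do rewrite big_nil.
  by rewrite big_nil charge_integral0.
rewrite big_cons IH; under [in RHS]eq_fun do rewrite big_cons add0r.
rewrite charge_integralD.
- rewrite charge_integralZ; last exact: continuous_dilate.
  by congr (_ + _); congr charge_integral; apply/funext => w; rewrite add0r.
- by apply: continuous_scale; exact: continuous_dilate.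
- have := @continuous_dilate _ 0 h (@comb_continuous s _ cf).
  by rewrite /comb; under [X in continuous X -> _]eq_fun do rewrite add0r.
Qed.

(** This is where the vanishing moments enter: a polynomial of degree at most
[n] can be subtracted from [comb s f] without changing the integral. *)
Lemma comb_Delta_le n s f (h rho E : R) P : continuous f ->
  (forall k, (multi_order k <= n)%N -> charge_integral sigma (monomial k) = 0) ->
  (forall w, K w -> supnorm_le rho w) -> 0 <= h -> 0 <= E -> poly_fn n P ->
  (forall z, supnorm_le (h * rho) z -> `|comb s f z - P z| <= E) ->
  `|\sum_(c <- s) c.1 * Delta sigma f c.2 h| <= E * charge_mass.
Proof.
move=> cf moments Krho h0 E0 nP fP; rewrite comb_Delta//.
pose g w := comb s f (0 + h *: w) + -1 * P (0 + h *: w).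
have cc := @continuous_dilate _ 0 h (@comb_continuous s _ cf).
have cP := @continuous_scale (-1) _ (@continuous_dilate _ 0 h (poly_fn_continuous nP)).
have -> : charge_integral sigma (fun w => comb s f (0 + h *: w)) =
    charge_integral sigma g.
  rewrite charge_integralD// charge_integralZ; last first.
    exact/continuous_dilate/(poly_fn_continuous nP).
  have := charge_integral_poly h moments nP.
  by under eq_fun do rewrite -[h *: _]add0r; move=> ->; rewrite mulr0 addr0.
apply: charge_integral_le => //; first exact: continuous_add.
move=> w Kw; rewrite /g add0r mulN1r; apply: fP.
by rewrite -[h in h * rho]ger0_norm//; apply: supnorm_leZ; exact: Krho.
Qed.

Lemma Delta_continuous f x : continuous f -> continuous (Delta sigma f x).
Proof.
move=> cf h; rewrite /Delta /charge_integral.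
by apply: (@continuousB _ _ _ (fun h : R => \int[charge_pos sigma]_w f (x + h *: w))
  (fun h : R => \int[charge_neg sigma]_w f (x + h *: w)));
  apply: (continuous_Rintegral_dilation cK).
Qed.

End ChargeIntegral.

(** * Integrals over intervals of scales *)

Section IntegralsOverIntervals.
Context {R : realType}.
Notation leb := (@lebesgue_measure R).
Implicit Types (g h : R -> R) (a b c : R).

Definition continuous_pos g : Prop := forall t : R, 0 < t -> {for t, continuous g}.

Lemma continuous_pos_scale c g : continuous_pos g ->
  continuous_pos (fun t => c * g t).
Proof.
move=> cg t t0; apply: (@continuousM _ _ (fun=> c) g); last exact: cg.
exact: cst_continuous.
Qed.

Lemma continuous_pos_integrable g a b : continuous_pos g -> 0 < a ->
  leb.-integrable `[a, b] (EFin \o g).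
Proof.
move=> cg a0; apply: continuous_compact_integrable; first exact: segment_compact.
apply: continuous_in_subspaceT => t; rewrite inE /= in_itv /= => /andP[at0 _].
by apply: cg; exact: lt_le_trans a0 at0.
Qed.

Lemma Rintegral_segment_le g a b (E : R) : continuous_pos g -> 0 < a -> a <= b ->
  0 <= E -> (forall t, a <= t <= b -> `|g t| <= E) ->
  `|\int[leb]_(t in `[a, b]) g t| <= E * (b - a).
Proof.
move=> cg a0 ab E0 gE; have ig := continuous_pos_integrable b cg a0.
apply: (le_trans (le_normr_Rintegral _ ig)) => //.
apply: (@le_trans _ _ (\int[leb]_(t in `[a, b]) E)).
  apply: le_Rintegral => //=.
  - by have := integrable_norm ig.
  - apply: (@continuous_pos_integrable (fun=> E)) => // t _.
    exact: cst_continuous.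
rewrite Rintegral_cst//= lebesgue_measure_itv /= lte_fin.
case: ltP => [_|ba]; first by rewrite -EFinD.
by rewrite /= mulr0 mulr_ge0// subr_ge0.
Qed.

Lemma Rintegral_segment_split g a b c : continuous_pos g -> 0 < a -> a <= b ->
  b <= c ->
  \int[leb]_(t in `[a, c]) g t =
  \int[leb]_(t in `[a, b]) g t + \int[leb]_(t in `[b, c]) g t.
Proof.
move=> cg a0 ab bc; have iac := continuous_pos_integrable c cg a0.
have := @Rintegral_itvB R g (BLeft a) (BRight c) b iac.
rewrite !bnd_simp => /(_ ab bc); rewrite Rintegral_itv_obnd_cbnd.
  by move=> <-; rewrite addrC subrK.
apply: (integrableS _ _ _ iac) => //; apply: subset_itvr.
by rewrite bnd_simp.
Qed.

End IntegralsOverIntervals.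

Section DyadicIntegrals.
Context {R : realType} {d : nat} (sigma : {charge set (borel_rV R d) -> \bar R}).
Context (K : set 'rV[R]_d) (cK : compact K)
  (sigmaK : Defs.total_variation sigma (~` K) = 0%E).
Context (m : nat) (alpha : R).
Notation leb := (@lebesgue_measure R).
Implicit Types (f g G P : 'rV[R]_d -> R) (x w z : 'rV[R]_d).
Implicit Types (k : 'I_d -> nat) (s : seq (R * 'rV[R]_d)).

Definition integrand f x (h : R) : R :=
  Delta sigma f x h / h `^ (m%:R + alpha) / h.

Lemma integrand_continuous f x : continuous f -> continuous_pos (integrand f x).
Proof.
move=> cf t t0; rewrite /integrand.
have tpow : t `^ (m%:R + alpha) != 0 by rewrite gt_eqF// powR_gt0.
apply: (@continuousM _ _ (fun h : R => Delta sigma f x h / h `^ (m%:R + alpha)) (fun h : R => h^-1)).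
  apply: (@continuousM _ _ (Delta sigma f x) (fun h : R => (h `^ (m%:R + alpha))^-1)).
    exact: (Delta_continuous cK sigmaK).
  apply: (@continuousV _ _ (fun h : R => h `^ (m%:R + alpha))) => //.
  apply: differentiable_continuous; apply/derivable1_diffP.
  by apply: derivable_powR; rewrite in_itv/= t0.
by apply: inv_continuous; rewrite gt_eqF.
Qed.

Lemma comb_integrand_continuous s f : continuous f ->
  continuous_pos (fun h => \sum_(c <- s) c.1 * integrand f c.2 h).
Proof.
move=> cf t t0; elim: s => [|c s IH].
  rewrite (_ : (fun h => _) = fun=> 0); first exact: cst_continuous.
  by apply/funext => h; rewrite big_nil.
rewrite (_ : (fun h => _) = (fun h => c.1 * integrand f c.2 h +
    \sum_(c <- s) c.1 * integrand f c.2 h)); last first.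
  by apply/funext => h; rewrite big_cons.
apply: (@continuousD _ _ _ (fun h => c.1 * integrand f c.2 h)) => //.
have h1 := continuous_pos_scale (c := c.1) (@integrand_continuous f c.2 cf) t0.
exact: h1.
Qed.

Lemma comb_segment (a b : R) s f : continuous f -> 0 < a ->
  \sum_(c <- s) c.1 * (\int[leb]_(h in `[a, b]) integrand f c.2 h) =
  \int[leb]_(h in `[a, b]) (\sum_(c <- s) c.1 * integrand f c.2 h).
Proof.
move=> cf a0; elim: s => [|c s IH].
  by rewrite big_nil; under eq_Rintegral do rewrite big_nil; rewrite Rintegral_cst// mul0r.
under [RHS]eq_Rintegral do rewrite big_cons.
have ic := continuous_pos_integrable b (@integrand_continuous f c.2 cf) a0.
rewrite big_cons IH RintegralD//; first by rewrite RintegralZl.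
- apply: (@continuous_pos_integrable _ (fun h => c.1 * integrand f c.2 h)) => //.
  exact/continuous_pos_scale/integrand_continuous.
- by apply: (@continuous_pos_integrable _ (fun h => \sum_(c <- s) c.1 * integrand f c.2 h)) => //;
    exact: comb_integrand_continuous.
Qed.

(** The length of the interval of integration is at most its left end [a],
hence the integral of [1 / h] over it is at most [1]. *)
Lemma comb_segment_le n (a b rho E : R) s f P : continuous f ->
  (forall k, (multi_order k <= n)%N -> charge_integral sigma (monomial k) = 0) ->
  (forall w, K w -> supnorm_le rho w) -> 0 <= rho -> 0 < alpha ->
  0 < a -> a <= b <= 2 * a ->
  0 <= E -> poly_fn n P ->
  (forall z, supnorm_le (b * rho) z -> `|comb s f z - P z| <= E) ->
  `|\sum_(c <- s) c.1 * (\int[leb]_(h in `[a, b]) integrand f c.2 h)| <=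
  E * charge_mass sigma / a `^ (m%:R + alpha).
Proof.
move=> cf moments Krho rho0 al0 a0 /andP[ab b2a] E0 nP fP; rewrite comb_segment//.
have pa0 : 0 < a `^ (m%:R + alpha) by rewrite powR_gt0.
have M0 := charge_mass_ge0 sigma.
apply: (@le_trans _ _ ((E * charge_mass sigma / a `^ (m%:R + alpha) / a) * (b - a))).
  apply: Rintegral_segment_le => //; first exact: comb_integrand_continuous.
    by rewrite !mulr_ge0 ?invr_ge0 ?(ltW a0) ?(ltW pa0).
  move=> h /andP[ah hb]; have h0 : 0 < h by exact: lt_le_trans ah.
  have -> : \sum_(c <- s) c.1 * integrand f c.2 h =
      (\sum_(c <- s) c.1 * Delta sigma f c.2 h) / h `^ (m%:R + alpha) / h.
    by rewrite !mulr_suml; apply: eq_bigr => c _; rewrite /integrand !mulrA.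
  rewrite !normrM !normfV (ger0_norm (powR_ge0 _ _)) (gtr0_norm h0).
  apply: ler_pM; rewrite ?mulr_ge0 ?invr_ge0 ?powR_ge0 ?(ltW h0)//; last first.
    by rewrite lef_pV2 ?posrE.
  apply: ler_pM; rewrite ?mulr_ge0 ?invr_ge0 ?powR_ge0 ?(ltW h0)//; last first.
    rewrite lef_pV2 ?posrE ?powR_gt0//.
    by rewrite ge0_ler_powR ?nnegrE ?(ltW a0) ?(ltW h0)// addr_ge0// ltW.
  apply: (comb_Delta_le cK sigmaK cf moments Krho (ltW h0) E0 nP) => z hz.
  by apply: fP; apply: supnorm_le_le hz; rewrite ler_wpM2r.
rewrite -mulrA ler_piMr ?mulr_ge0 ?invr_ge0 ?(ltW pa0)//.
by rewrite mulrC ler_pdivrMr// mul1r; lra.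
Qed.

Definition dyadic_integral (j : nat) f x : R :=
  \int[leb]_(h in `[side j.+1, side j]) integrand f x h.

Lemma integral_dyadic_split f x (n : nat) (eps : R) : continuous f -> 0 < eps ->
  eps <= side n ->
  \int[leb]_(h in `[eps, 1]) integrand f x h =
  \sum_(j < n) dyadic_integral j f x + \int[leb]_(h in `[eps, side n]) integrand f x h.
Proof.
move=> cf eps0; have cI := @integrand_continuous f x cf.
have sideS_le j : @side R j.+1 <= side j.
  by have := @side_gt0 R j.+1; rewrite (sideS j); lra.
elim: n => [|n IH] en; first by rewrite big_ord0 add0r.
rewrite big_ord_recr /= IH ?(le_trans en)//.
rewrite (@Rintegral_segment_split _ _ eps (side n.+1))//.
by rewrite -addrA [in RHS](addrC (dyadic_integral _ _ _)).
Qed.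

End DyadicIntegrals.

(** * Estimates at one scale and means of the partial sums *)

Lemma powR_div (R : realType) (x y p : R) : 0 <= x -> 0 <= y ->
  (x / y) `^ p = x `^ p / y `^ p.
Proof.
move=> x0 y0; rewrite powRM ?invr_ge0//; congr (_ * _).
by rewrite -[y^-1]powR_inv1// -powRrM mulN1r powRN.
Qed.

Section GeometricSums.
Context {R : realType}.
Implicit Types (t p : R).

Lemma geometric_sum_le t n : 0 <= t -> t < 1 ->
  \sum_(0 <= j < n) t ^+ j <= (1 - t)^-1.
Proof.
move=> t0 t1; have t1' : 0 < 1 - t by rewrite subr_gt0.
have -> : \sum_(0 <= j < n) t ^+ j = (1 - t ^+ n) / (1 - t).
  elim: n => [|n IH]; first by rewrite big_geq// expr0 subrr mul0r.
  by rewrite big_nat_recr//= IH exprS; field; rewrite gt_eqF.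
by rewrite ler_pdivrMr// mulVf ?gt_eqF// gerBl exprn_ge0.
Qed.

Lemma geometric_sum_rev_le t i : 0 <= t -> t < 1 ->
  \sum_(0 <= j < i) t ^+ (i - j) <= (1 - t)^-1.
Proof.
move=> t0 t1; rewrite big_nat_rev /= add0n.
apply: le_trans (geometric_sum_le i t0 t1); rewrite big_nat [leRHS]big_nat.
apply: ler_sum => j /andP[_ ji]; rewrite subKn//.
by rewrite exprS ler_piMl ?exprn_ge0// ltW.
Qed.

Lemma side_powR n p : @side R n `^ p = (2^-1 `^ p) ^+ n.
Proof. by rewrite /side -powR_mulrn// -powR_mulrn ?powR_ge0// powRAC. Qed.

Lemma side_div i j : (j <= i)%N -> @side R i / side j = side (i - j).
Proof.
by move=> ji; rewrite /side -[in X in X / _](subnK ji) exprD mulfK//.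
Qed.

Lemma half_powR_lt1 p : 0 < p -> (2^-1 : R) `^ p < 1.
Proof.
move=> p0; have h : (2^-1 : R) < 1 by lra.
by rewrite -[ltRHS](congr1 (@^~ p) (@powR1 R)) gt0_ltr_powR ?nnegrE.
Qed.

Lemma side_le1 n : @side R n <= 1.
Proof. by rewrite exprn_ile1// invf_le1 ?ler1n. Qed.

Lemma side_antimono i j : (i <= j)%N -> @side R j <= side i.
Proof. by move=> ij; apply: ler_wiXn2l; rewrite ?invr_ge0// invf_le1 ?ler1n. Qed.

Lemma side_powR_small p (N : nat) (t : R) : 0 < p -> 0 < t ->
  exists2 n : nat, (N <= n)%N & @side R n `^ p <= t.
Proof.
move=> p0 t0; pose t' := t `^ p^-1.
have t'0 : 0 < t' by rewrite powR_gt0.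
exists (N + (Num.truncn t'^-1).+1)%N; first by rewrite leq_addr.
have -> : t = t' `^ p by rewrite /t' -powRrM mulVf ?gt_eqF// powRr1// ltW.
rewrite ge0_ler_powR ?nnegrE ?(ltW p0) ?(ltW t'0) ?(ltW (side_gt0 _))//.
rewrite /side exprVn -[leRHS]invrK lef_pV2 ?posrE ?invr_gt0 ?exprn_gt0//.
apply: (le_trans (ltW (truncnS_gt _))); rewrite -natrX ler_nat.
rewrite addnS; apply: (@leq_trans (2 ^ (Num.truncn t'^-1).+1)).
  by rewrite ltnW// ltn_expl.
by rewrite leq_exp2l// -addnS leq_addl.
Qed.

End GeometricSums.

Section Estimates.
Context {R : realType} {d m : nat} {alpha : R}.
Context {sigma : {charge set (borel_rV R d) -> \bar R}}.
Context (alpha_gt0 : 0 < alpha) (alpha_le1 : alpha <= 1).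
Context {K : set 'rV[R]_d} (cK : compact K)
  (sigmaK : Defs.total_variation sigma (~` K) = 0%E).
Context {rho : R} (rho1 : 1 <= rho) (Krho : forall w, K w -> supnorm_le rho w).
Let e : nat := alpha == 1.
Context (moments : forall k, (multi_order k <= m + e)%N ->
  charge_integral sigma (monomial k) = 0).
Context {CT : R} (CT0 : 0 <= CT) (taylor : forall f s (r eps : R), 0 <= r ->
  0 <= eps -> times_differentiable m f ->
  (forall k, multi_order k = m -> exists2 P, poly_fn e P & forall z,
     supnorm_le r z -> `|comb s (multi_partial k f) z - P z| <= eps) ->
  exists2 P : 'rV[R]_d -> R, poly_fn (m + e) P & forall z, supnorm_le r z ->
    `|comb s f z - P z| <= CT * eps * r ^+ m).
Context {beta CH : R} (beta_gt0 : 0 < beta) (beta_le : beta <= alpha)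
  (beta_lt1 : beta < 1) (CH0 : 0 < CH).
Context (approx : forall (u : 'rV[R]_d -> R) (B : R), 0 <= B -> holder alpha u ->
    (holder_seminorm alpha u <= B%:E)%E ->
  forall y (r : R), 0 < r ->
  exists2 b, (alpha != 1 -> b = 0) &
  forall p q (s : R), 0 <= s -> supnorm_le r (p - y) -> supnorm_le r (q - y) ->
    supnorm_le s (p - q) ->
    `|(u p - lin b p) - (u q - lin b q)| <=
      CH * B * r `^ (alpha - beta) * s `^ beta).
Context (f : 'rV[R]_d -> R) (B : R) (B0 : 0 <= B).
Context (fdiff : times_differentiable m f) (fc : continuous f).
Context (fH : forall k, multi_order k = m -> holder alpha (multi_partial k f) /\
  (holder_seminorm alpha (multi_partial k f) <= B%:E)%E).
Notation leb := (@lebesgue_measure R).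
Notation seg a b x := (\int[leb]_(h in `[a, b]) integrand sigma m alpha f x h).

Definition segment_const : R := CT * charge_mass sigma * (2 * rho) ^+ m * 2.

Let rho0 : 0 < rho. Proof. exact: lt_le_trans rho1. Qed.

Lemma segment_const_ge0 : 0 <= segment_const.
Proof.
have M0 := charge_mass_ge0 sigma.
by rewrite /segment_const !mulr_ge0 ?exprn_ge0 ?mulr_ge0 ?(ltW rho0).
Qed.

Lemma poly_fn_affine_degree (a : R) b : (alpha != 1 -> b = 0) ->
  poly_fn e (fun z : 'rV[R]_d => a + lin b z).
Proof.
rewrite /e; have [_ _|_ /(_ isT) ->] := eqVneq alpha 1; first exact: poly_fn_affine.
by under eq_fun do rewrite lin0; exact: poly_fn_cst.
Qed.

(** The common source of the three estimates below, which only differ in the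
combination of translates. *)
Lemma segment_estimate s (a b eps : R) : 0 < a -> a <= b <= 2 * a -> 0 <= eps ->
  (forall k, multi_order k = m -> exists a0 b0, (alpha != 1 -> b0 = 0) /\
     forall z, supnorm_le (b * rho) z ->
       `|comb s (multi_partial k f) z - (a0 + lin b0 z)| <= eps) ->
  `|\sum_(c <- s) c.1 * seg a b c.2| <= segment_const * (eps / b `^ alpha).
Proof.
move=> a0 /andP[ab b2a] eps0 sP; have b0 : 0 < b by exact: lt_le_trans ab.
have r0 : 0 <= b * rho by rewrite mulr_ge0 ?ltW.
have [k km|P nP fP] := taylor (s := s) r0 eps0 fdiff.
  have [c0 [b1 [b10 H]]] := sP k km.
  by exists (fun z => c0 + lin b1 z) => //; exact: poly_fn_affine_degree.
have := @comb_segment_le _ _ _ _ cK sigmaK m alpha _ a b rho _ s f P fc moments Krho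
  (ltW rho0) alpha_gt0 a0 _ _ nP fP.
rewrite ab b2a => /(_ isT); rewrite !mulr_ge0 ?exprn_ge0// => /(_ isT).
move=> /le_trans; apply.
have M0 := charge_mass_ge0 sigma.
have pa : 0 < a `^ alpha by rewrite powR_gt0.
have pb : 0 < b `^ alpha by rewrite powR_gt0.
have h1 : (b * rho) ^+ m / a `^ (m%:R + alpha) <= (2 * rho) ^+ m * 2 / b `^ alpha.
  rewrite powRD; last by rewrite (gt_eqF a0) implybT.
  rewrite powR_mulrn ?(ltW a0)// invfM mulrA.
  rewrite -[leRHS]mulrA; apply: ler_pM.
  - by rewrite divr_ge0 ?exprn_ge0 ?(ltW a0).
  - by rewrite invr_ge0 ltW.
  - rewrite -exprVn -exprMn lerXn2r ?nnegrE ?mulr_ge0 ?invr_ge0 ?(ltW a0) ?(ltW rho0) ?(ltW b0)//.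
    by rewrite ler_pdivrMr// mulrAC ler_wpM2r// ltW.
  - rewrite ler_pdivlMr// mulrC -ler_pdivlMr ?invr_gt0// invrK.
    apply: (@le_trans _ _ ((2 * a) `^ alpha)).
      by rewrite ge0_ler_powR ?nnegrE ?mulr_ge0 ?(ltW a0) ?(ltW b0) ?(ltW alpha_gt0).
    rewrite powRM ?(ltW a0)// ler_wpM2r ?(ltW pa)//.
    by rewrite -[leRHS]powRr1//; apply: ler_powR => //; rewrite ler1n.
have h2 : 0 <= CT * eps * charge_mass sigma by rewrite !mulr_ge0.
have := ler_wpM2l h2 h1; rewrite /segment_const.
by congr (_ <= _); ring.
Qed.

Definition increment_const : R := segment_const * CH * rho `^ alpha.

Lemma segment_le a b x : 0 < a -> a <= b <= 2 * a ->
  `|seg a b x| <= increment_const * B.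
Proof.
move=> a0 ab; have b0 : 0 < b by case/andP: ab => ab _; exact: lt_le_trans ab.
have r0 : 0 < b * rho by rewrite mulr_gt0.
have := @segment_estimate [:: (1, x)] a b
  (CH * B * (b * rho) `^ (alpha - beta) * (b * rho) `^ beta) a0 ab.
rewrite big_seq1 mul1r => /(_ _)/wrap[|].
  by rewrite !mulr_ge0 ?powR_ge0// ltW.
move=> /(_ _)/wrap[k km|].
  have [uh uB] := fH km; have [b1 b10 H] := approx B0 uh uB x r0.
  exists (multi_partial k f x), b1; split=> // z rz; rewrite /comb big_seq1 mul1r.
  have := H (x + z) x (b * rho) (ltW r0); rewrite subrr addrAC subrr add0r => /(_ rz).
  move=> /(_ (supnorm_le0 (ltW r0)) rz); rewrite linD.
  by rewrite (_ : _ - _ - _ = multi_partial k f (x + z) - (multi_partial k f x + lin b1 z)) //; ring.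
have ba : 0 < b `^ alpha by rewrite powR_gt0.
have rE : (b * rho) `^ (alpha - beta) * (b * rho) `^ beta = b `^ alpha * rho `^ alpha.
  rewrite -powRD; last by rewrite (gt_eqF r0) implybT.
  by rewrite subrK powRM ?(ltW b0) ?(ltW rho0).
rewrite -(mulrA (CH * B)) rE (_ : _ / _ = CH * rho `^ alpha * B); last first.
  by field; rewrite gt_eqF.
by rewrite /increment_const !mulrA.
Qed.

(** Within a distance [l] that is small with respect to the scale [b] the
Hoelder condition of the derivatives with exponent [beta] gains a factor
[(l / b) `^ beta].  The affine function only contributes a constant to the
difference of two translates. *)
Lemma segment_diff_le a b p x (l : R) : 0 < a -> a <= b <= 2 * a -> 0 <= l ->
  l <= b -> supnorm_le l (p - x) ->
  `|seg a b p - seg a b x| <=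
    segment_const * CH * (2 * rho) `^ (alpha - beta) * B * (l / b) `^ beta.
Proof.
move=> a0 ab l0 lb lpx.
have b0 : 0 < b by case/andP: ab => ab _; exact: lt_le_trans ab.
have r0 : 0 < b * rho by rewrite mulr_gt0.
have r20 : 0 < 2 * (b * rho) by rewrite mulr_gt0.
have := @segment_estimate [:: (1, p); (-1, x)] a b
  (CH * B * (2 * (b * rho)) `^ (alpha - beta) * l `^ beta) a0 ab.
rewrite big_cons big_seq1 mul1r mulN1r => /(_ _)/wrap[|].
  by rewrite !mulr_ge0 ?powR_ge0// ltW.
move=> /(_ _)/wrap[k km|].
  have [uh uB] := fH km; have [b1 b10 H] := approx B0 uh uB x r20.
  exists (lin b1 (p - x)), 0; split=> // z rz; rewrite /comb big_cons big_seq1 mul1r mulN1r.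
  have := H (p + z) (x + z) l l0; rewrite /=.
  have -> : x + z - x = z by rewrite addrAC subrr add0r.
  have -> : p + z - (x + z) = p - x by rewrite opprD addrACA subrr addr0.
  have -> : p + z - x = p - x + z by rewrite addrAC.
  move=> /(_ _)/wrap[|].
    apply: supnorm_le_le (supnorm_leD lpx rz); rewrite mulr2n mulrDl mul1r lerD2r.
    by rewrite (le_trans lb)// ler_peMr// ltW.
  move=> /(_ _ lpx)/wrap[|]; first by apply: supnorm_le_le rz; lra.
  rewrite lin0 addr0 linB !linD.
  by congr (`|_| <= _); ring.
have bb : 0 < b `^ beta by rewrite powR_gt0.
have ba : 0 < b `^ alpha by rewrite powR_gt0.
have -> : (2 * (b * rho)) `^ (alpha - beta) =
    b `^ alpha / b `^ beta * (2 * rho) `^ (alpha - beta).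
  rewrite (_ : 2 * (b * rho) = b * (2 * rho)); last by ring.
  rewrite (@powRM _ b (2 * rho)) ?mulr_ge0 ?(ltW b0) ?(ltW rho0)//.
  by rewrite powRB// (gt_eqF b0) implybT.
rewrite powR_div ?(ltW b0)//.
rewrite (_ : _ / b `^ alpha = CH * (2 * rho) `^ (alpha - beta) * B *
  (l `^ beta / b `^ beta)); last by field; rewrite !gt_eqF.
by rewrite !mulrA.
Qed.

(** The exponent of the decay of the means.  If [alpha < 1] the linear part of
the mean of the derivatives is not killed by [sigma], and its size limits the
decay.  If [alpha = 1] the modulus of continuity does. *)
Definition decay : R := if alpha == 1 then beta else 1 - alpha.

Lemma decay_gt0 : 0 < decay.
Proof.
rewrite /decay; have [//|aN] := eqVneq alpha 1.
by rewrite subr_gt0 lt_neqAle aN.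
Qed.

Definition mean_const : R := segment_const * CH *
  (d%:R * (3 + rho) `^ (alpha - beta) * (2 * rho * rho `^ beta + rho + 2)).

(** The homogeneity count behind [segment_mean_le]: [K] is the constant in the
Hoelder condition on a cube of side comparable to [l].  The three terms on the
left are the error of the affine approximation, the rounding error, and, if
[alpha < 1], the linear part of the approximation. *)
Lemma mean_powers (a1 b l eta : R) : 0 <= a1 -> 0 < b -> b <= l -> l <= 1 -> 0 <= eta ->
  let K := a1 * ((3 + rho) * l) `^ (alpha - beta) in
  (d%:R * (2 * K * (b * rho / l) * (b * rho) `^ beta + 2 * K * eta `^ beta) +
    (alpha != 1)%:R * (d%:R * (K * l `^ beta / l * (b * rho)))) / b `^ alpha <=
  a1 * (d%:R * (3 + rho) `^ (alpha - beta) * (2 * rho * rho `^ beta + rho + 2)) *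
    ((b / l) `^ decay + eta `^ beta / b).
Proof.
move=> a10 b0 bl l1 eta0 /=.
set K1 := a1 * ((3 + rho) * l) `^ (alpha - beta).
have l0 : 0 < l by exact: lt_le_trans bl.
have t0 : 0 < b / l by rewrite divr_gt0.
have t1 : b / l <= 1 by rewrite ler_pdivrMr// mul1r.
pose kappa := (3 + rho) `^ (alpha - beta).
have k0 : 0 <= kappa by exact: powR_ge0.
have [bb ba lb la] : [/\ 0 < b `^ beta, 0 < b `^ alpha, 0 < l `^ beta & 0 < l `^ alpha].
  by split; rewrite powR_gt0.
have rb : 0 <= rho `^ beta by exact: powR_ge0.
have KE : K1 = a1 * kappa * (l `^ alpha / l `^ beta).
  rewrite /K1 powRM ?(ltW l0) ?addr_ge0 ?(ltW rho0)// -/kappa mulrA.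
  by rewrite [l `^ (_ - _)]powRB// (gt_eqF l0) implybT.
have T1 : K1 * (b * rho / l) * (b * rho) `^ beta / b `^ alpha <=
    a1 * kappa * (rho * rho `^ beta) * (b / l) `^ decay.
  rewrite KE (@powRM _ b rho) ?(ltW b0) ?(ltW rho0)//.
  have -> : a1 * kappa * (l `^ alpha / l `^ beta) * (b * rho / l) *
      (b `^ beta * rho `^ beta) / b `^ alpha =
    a1 * kappa * (rho * rho `^ beta) * (b / l * (b `^ beta / l `^ beta) / (b `^ alpha / l `^ alpha)).
    by field; rewrite !gt_eqF.
  rewrite ler_wpM2l ?mulr_ge0 ?(ltW rho0)//.
  rewrite -!powR_div ?(ltW b0) ?(ltW l0)//.
  rewrite -[X in X * _ / _](@powRr1 _ (b / l)) ?(ltW t0)//.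
  rewrite -powRD ?(gt_eqF t0) ?implybT// -powRB ?(gt_eqF t0) ?implybT//.
  apply: ger_powR; rewrite ?t0 ?t1// /decay; case: eqP => [->|_]; first lra.
  by have := beta_gt0; lra.
have T2 : K1 * eta `^ beta / b `^ alpha <= a1 * kappa * (eta `^ beta / b).
  rewrite /K1 powRM ?(ltW l0) ?addr_ge0 ?(ltW rho0)// -/kappa.
  rewrite -!mulrA; do 2 rewrite ler_wpM2l//.
  rewrite mulrCA ler_wpM2l ?powR_ge0// -[leRHS]mul1r ler_pM ?powR_ge0 ?invr_ge0 ?powR_ge0//.
    rewrite -(powRr0 l); apply: ger_powR; rewrite ?l0 ?l1// subr_ge0; exact: beta_le.
  rewrite lef_pV2 ?posrE// -[leLHS]powRr1 ?(ltW b0)//.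
  by apply: ger_powR; rewrite ?b0 ?(le_trans bl l1).
have T3 : (alpha != 1)%:R * (K1 * l `^ beta / l * (b * rho)) / b `^ alpha <=
    a1 * kappa * rho * (b / l) `^ decay.
  rewrite /decay; have [->|aN] := eqVneq alpha 1.
    by rewrite !mul0r !mulr_ge0 ?powR_ge0 ?(ltW rho0).
  rewrite mul1r KE.
  have -> : a1 * kappa * (l `^ alpha / l `^ beta) * l `^ beta / l * (b * rho) / b `^ alpha =
     a1 * kappa * rho * (b / l / (b `^ alpha / l `^ alpha)).
    by field; rewrite !gt_eqF.
  rewrite -powR_div ?(ltW b0) ?(ltW l0)// -[X in X / _](@powRr1 _ (b / l)) ?(ltW t0)//.
  by rewrite -powRB// (gt_eqF t0) implybT.
have d0 : 0 <= d%:R :> R by [].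
have D0 : 0 <= (b / l) `^ decay by exact: powR_ge0.
have E0 : 0 <= eta `^ beta / b by rewrite divr_ge0 ?powR_ge0 ?(ltW b0).
rewrite -/kappa; set D := (b / l) `^ decay in T1 T3 D0 *; set E := eta `^ beta / b in T2 E0 *.
apply: (@le_trans _ _ (d%:R * (2 * (a1 * kappa * (rho * rho `^ beta) * D) +
  2 * (a1 * kappa * E) + a1 * kappa * rho * D))).
  set lhs := (leLHS).
  have -> : lhs = d%:R * (2 * (K1 * (b * rho / l) * (b * rho) `^ beta / b `^ alpha) +
     2 * (K1 * eta `^ beta / b `^ alpha) +
     (alpha != 1)%:R * (K1 * l `^ beta / l * (b * rho)) / b `^ alpha).
    by rewrite /lhs; field; rewrite !gt_eqF.
  by rewrite ler_wpM2l// lerD// lerD// ler_wpM2l.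
have G0 : 0 <= a1 * kappa * d%:R by rewrite !mulr_ge0.
have R1 : 0 <= rho * rho `^ beta by rewrite mulr_ge0// ltW.
rewrite -subr_ge0.
rewrite (_ : _ - _ = a1 * kappa * d%:R * (2 * D + (2 * (rho * rho `^ beta) + rho) * E)).
  by rewrite mulr_ge0// addr_ge0// mulr_ge0// addr_ge0// ?mulr_ge0// ltW.
ring.
Qed.

(** Cancellation over a cube whose side is large with respect to the
scale [b]. *)
Lemma segment_mean_le a b y M (eta : R) : 0 < a -> a <= b <= 2 * a -> 0 < eta ->
  b <= 2 ^+ M * eta -> 2 ^+ M * eta <= 1 ->
  `|grid_mean (@bits R d) M eta (fun q => seg a b (y + q))| <=
    mean_const * B * ((b / (2 ^+ M * eta)) `^ decay + eta `^ beta / b).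
Proof.
move=> a0 ab eta0; set l := 2 ^+ M * eta => bl l1.
have b0 : 0 < b by case/andP: ab => ab _; exact: lt_le_trans ab.
have l0 : 0 < l by exact: lt_le_trans bl.
pose K1 := CH * B * ((3 + rho) * l) `^ (alpha - beta).
have K10 : 0 <= K1 by rewrite !mulr_ge0 ?powR_ge0// ltW.
have [s sE] := grid_mean_comb (@bits R d) M eta.
pose s' := [seq (c.1, y + c.2) | c <- s].
have s'E (g : 'rV[R]_d -> R) : \sum_(c <- s') c.1 * g c.2 =
    grid_mean (@bits R d) M eta (fun q => g (y + q)).
  by rewrite sE big_map.
have r0 : 0 <= b * rho by rewrite mulr_ge0 ?ltW.
pose eps := d%:R * (2 * K1 * (b * rho / l) * (b * rho) `^ beta + 2 * K1 * eta `^ beta) +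
    (alpha != 1)%:R * (d%:R * (K1 * l `^ beta / l * (b * rho))).
have eps0 : 0 <= eps.
  apply: addr_ge0; apply: mulr_ge0 => //; first apply: addr_ge0.
  all: rewrite ?mulr_ge0 ?ler0n ?powR_ge0 ?invr_ge0 ?(ltW l0) ?(ltW b0) ?(ltW rho0) ?(ltW CH0)//.
have := @segment_estimate s' a b eps a0 ab eps0.
rewrite (s'E (fun x => seg a b x)) => /(_ _)/wrap[k km|]; last first.
  move=> /le_trans; apply.
  have := @mean_powers (CH * B) b l eta (mulr_ge0 (ltW CH0) B0) b0 bl l1 (ltW eta0).
  rewrite /= -/K1 -/eps => /(ler_wpM2l segment_const_ge0) /le_trans; apply.
  rewrite /mean_const; set X := _ + eta `^ beta / b.
  by rewrite le_eqVlt; apply/orP; left; apply/eqP; ring.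
have [uh uB] := fH km; have rl : 0 < (3 + rho) * l by rewrite mulr_gt0// addr_gt0.
have [b1 b10 H] := approx B0 uh uB y rl; set u := multi_partial k f in H *.
pose v q := u (y + q) - lin b1 (y + q).
have lr : 3 * l + b * rho <= (3 + rho) * l.
  by rewrite [leRHS]mulrDl lerD2l mulrC ler_wpM2l// ltW.
have [|b2 b2l Hv] := @grid_mean_affine_approx R d v K1 beta _ M eta (b * rho)
  beta_gt0 (ltW beta_lt1) K10 eta0 r0 lr.
  move=> p q t t0 rp rq tpq; apply: (H (y + p) (y + q) t t0).
  - by rewrite [y + _ - y]addrAC subrr add0r.
  - by rewrite [y + _ - y]addrAC subrr add0r.
  - by rewrite opprD addrACA subrr add0r.
pose gm := grid_mean (@bits R d) M eta.
have uE z : comb s' u z = gm (fun q => v (q + z)) + gm (fun q => lin b1 (y + q)) + lin b1 z.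
  rewrite /comb (s'E (fun x => u (x + z))).
  have h1 := grid_meanB (@bits R d) M eta (fun q => u (y + q + z)) (fun q => v (q + z)).
  have h2 := grid_meanB (@bits R d) M eta
    (fun q => lin b1 (y + q) + lin b1 z) (fun q => lin b1 (y + q)).
  rewrite [LHS](@eq_grid_mean _ _ _ _ _ _ (fun=> lin b1 z)) in h2; last first.
    by move=> q; rewrite addrC addKr.
  rewrite grid_mean_cst in h2.
  rewrite [LHS](@eq_grid_mean _ _ _ _ _ _ (fun q => lin b1 (y + q) + lin b1 z)) in h1; last first.
    by move=> q; rewrite /v !linD addrA; ring.
  by rewrite /gm; lra.
exists (gm v + gm (fun q => lin b1 (y + q))).
have [a1|aN] := eqVneq alpha 1.
  exists (b1 + b2); split=> // z rz; rewrite uE.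
  have -> : lin (b1 + b2) z = lin b1 z + lin b2 z.
    by rewrite /lin -big_split; apply: eq_bigr => i _; rewrite mxE mulrDl.
  have := Hv z rz; rewrite /eps a1 eqxx mul0r addr0.
  by congr (`|_| <= _); rewrite /gm; ring.
exists 0; split=> // z rz; rewrite uE lin0 addr0.
have -> : lin b1 z = 0 by rewrite b10// lin0.
rewrite addr0.
have h1 := Hv z rz.
have h2 := lin_supnorm_le b2l (divr_ge0 (mulr_ge0 K10 (powR_ge0 _ _)) (ltW l0)) rz.
rewrite /eps aN mul1r.
have -> : gm (fun q => v (q + z)) + gm (fun q => lin b1 (y + q)) -
  (gm v + gm (fun q => lin b1 (y + q))) =
  (gm (fun q => v (q + z)) - gm v - lin b2 z) + lin b2 z by ring.
by apply: (le_trans (ler_normD _ _)); exact: lerD.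
Qed.

Notation F j x := (dyadic_integral sigma m alpha j f x).

Definition partial_sum n x : R := \sum_(0 <= j < n) F j x.

Definition martingale_const : R :=
  segment_const * CH * (2 * rho) `^ (alpha - beta) / (1 - 2^-1 `^ beta) +
  mean_const * ((1 - 2^-1 `^ decay)^-1 + 1).

Let side_le j : @side R j.+1 <= @side R j <= 2 * @side R j.+1.
Proof. by have := @side_gt0 R j.+1; rewrite (sideS j); lra. Qed.

Lemma mean_const_ge0 : 0 <= mean_const.
Proof.
rewrite /mean_const; apply: mulr_ge0; last by rewrite !(mulr_ge0, addr_ge0) ?powR_ge0 ?(ltW rho0).
by rewrite mulr_ge0 ?segment_const_ge0 ?(ltW CH0).
Qed.

(** In the mean of [partial_sum N] over a cube of side [side i], the integrals
over the first [i] intervals differ little from their value at a point of the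
cube, and the later ones have small mean.  Both errors are summed as geometric
series. *)
Lemma partial_sum_means N : exists X : nat -> 'rV[R]_d -> R,
  (forall i y, (i < N)%N ->
     X i y = 2^-1 ^+ d * \sum_a X i.+1 (y + side i.+1 *: bits a)) /\
  (forall i y x, (i <= N)%N -> cube (side i) y x ->
     `|partial_sum i x - X i y| <= martingale_const * B).
Proof.
(* The grid is so fine that the rounding errors of the [N] scales, of order
   [eta `^ beta / side N] each, add up to at most 1. *)
have sN : 0 < @side R N / N.+1%:R by rewrite divr_gt0 ?side_gt0.
have [N' NN' N'small] := side_powR_small N beta_gt0 sN.
set eta := @side R N' in N'small.
have eta0 : 0 < eta by exact: side_gt0.
have etaE i : (i <= N')%N -> 2 ^+ (N' - i) * eta = side i :> R.
  move=> iN; rewrite /eta /side -[in X in _ * _ ^+ X](subnK iN) exprD mulrA.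
  by rewrite -exprMn mulfV// expr1n mul1r.
clearbody eta.
pose X i y := grid_mean (@bits R d) (N' - i) eta (fun q => partial_sum N (y + q)).
exists X; split=> [i y iN|i y x iN yx].
  have iN' : (i < N')%N by exact: leq_trans NN'.
  rewrite /X (_ : (N' - i = (N' - i.+1).+1)%N); last by rewrite subnSK.
  exact: grid_mean_split_at (etaE i.+1 iN').
have iN' := leq_trans iN NN'.
have qE (q : 'rV[R]_d) : cube ((2 ^+ (N' - i) - 1) * eta) 0 q ->
    forall j, 0 <= q 0 j <= side i.
  move=> /cubeP qc j; have := qc j; rewrite mxE mulrBl etaE// add0r mul1r.
  by move=> /andP[-> h] /=; apply: (le_trans h); rewrite gerBl ltW.
pose M j := grid_mean (@bits R d) (N' - i) eta (fun q => F j (y + q)).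
have XE : X i y = \sum_(0 <= j < N) M j.
  by rewrite /X /partial_sum /M -grid_mean_sum.
have early j : (j < i)%N -> `|F j x - M j| <=
    segment_const * CH * (2 * rho) `^ (alpha - beta) * B * (2^-1 `^ beta) ^+ (i - j).
  move=> ji; rewrite /M -(grid_mean_cst (@bits R d) (N' - i) eta (F j x)) -grid_meanB.
  apply: grid_mean_norm_le; [exact: unit_digits_bits|exact: ltW|].
  move=> q /qE qi; rewrite -side_powR -side_div 1?ltnW// distrC.
  apply: segment_diff_le; [exact: side_gt0|exact: side_le|exact/ltW/side_gt0| |].
    rewrite -[leLHS]mul1r -ler_pdivlMr ?side_gt0// -invf_div side_div 1?ltnW//.
    by rewrite invf_ge1 ?side_gt0 ?side_le1.
  move=> k; have := qi k; have := (cubeP _ _ _).1 yx k.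
  by rewrite !mxE ler_norml; lra.
have mB0 : 0 <= mean_const * B := mulr_ge0 mean_const_ge0 B0.
have late j : (i <= j < N)%N -> `|M j| <=
    mean_const * B * ((2^-1 `^ decay) ^+ (j - i) + N.+1%:R^-1).
  move=> /andP[ij jN]; have := @segment_mean_le (side j.+1) (side j) y (N' - i) eta
    (side_gt0 _) (side_le j) eta0.
  have sji : side j <= side i :> R.
    exact: side_antimono.
  rewrite etaE// => /(_ sji (side_le1 i)) /le_trans; apply.
  rewrite (ler_wpM2l mB0)//.
  rewrite side_div// side_powR lerD2l ler_pdivrMr ?side_gt0// mulrC.
  apply: (le_trans N'small); rewrite ler_wpM2r ?invr_ge0//.
  exact/side_antimono/ltnW.
rewrite XE (big_cat_nat (leq0n i) iN)//= /partial_sum opprD addrA -sumrB.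
apply: (le_trans (ler_normB _ _)).
rewrite /martingale_const mulrDl; apply: lerD.
  apply: (le_trans (ler_norm_sum _ _ _)).
  apply: (@le_trans _ _ (\sum_(0 <= j < i) segment_const * CH *
      (2 * rho) `^ (alpha - beta) * B * (2^-1 `^ beta) ^+ (i - j))).
    by rewrite !big_nat; apply: ler_sum => j /andP[_ ji]; exact: early.
  rewrite -mulr_sumr [leRHS]mulrAC ler_wpM2l//.
    by apply: mulr_ge0 B0; apply: mulr_ge0 (powR_ge0 _ _);
      exact: mulr_ge0 segment_const_ge0 (ltW CH0).
  by rewrite geometric_sum_rev_le ?powR_ge0// half_powR_lt1.
apply: (le_trans (ler_norm_sum _ _ _)).
apply: (@le_trans _ _ (\sum_(i <= j < N) mean_const * B *
    ((2^-1 `^ decay) ^+ (j - i) + N.+1%:R^-1))).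
  by rewrite !big_nat; apply: ler_sum => j; exact: late.
rewrite -mulr_sumr [leRHS]mulrAC (ler_wpM2l mB0)//.
rewrite big_split /= lerD//.
  rewrite -{1}[i]add0n big_addn.
  rewrite (eq_bigr (fun j => (2^-1 `^ decay) ^+ j)) => [|j _]; last by rewrite addnK.
  by rewrite geometric_sum_le ?powR_ge0// half_powR_lt1// decay_gt0.
rewrite sumr_const_nat -[leLHS]mulr_natl ler_pdivrMr// mul1r ler_nat.
by rewrite (leq_trans (leq_subr _ _))// leqnSn.
Qed.

End Estimates.

(** * Finiteness and continuity in Hoelder spaces *)

Section HolderSpaceNorm.
Context {R : realType} {d : nat}.
Implicit Types (f u : 'rV[R]_d -> R) (k : 'I_d -> nat) (alpha : R).

Lemma holder_seminorm_ge0 alpha u : (0 < d)%N -> (0 <= holder_seminorm alpha u)%E.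
Proof.
move=> d0; have z0 : const_mx 1 != 0 :> 'rV[R]_d.
  apply/eqP => /rowP/(_ (Ordinal d0)); rewrite !mxE => /eqP.
  by rewrite oner_eq0.
apply: (@le_trans _ _ (holder_quotient alpha u 0 (const_mx 1))%:E).
  rewrite lee_fin /holder_quotient; case: ifP => _.
    by rewrite divr_ge0// sqrtr_ge0.
  by rewrite divr_ge0// powR_ge0.
by apply: ereal_sup_ubound; exists (0, const_mx 1).
Qed.

Lemma holder_continuous alpha u : 0 < alpha -> (0 < d)%N -> holder alpha u ->
  continuous u.
Proof.
move=> a0 d0 [uc ufin]; have [/uc//|aN] := eqVneq alpha 1.
have s0 := holder_seminorm_ge0 alpha u d0.
pose B := fine (holder_seminorm alpha u).
have uB : (holder_seminorm alpha u <= B%:E)%E.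
  by rewrite fineK// ge0_fin_numE.
have B0 : 0 <= B by rewrite fine_ge0.
move=> x; apply: (proj2 (@cvgrPdist_le _ _ _ (nbhs x) (nbhs_filter x) u (u x))) => e e0.
have d0R : (0 : R) < d%:R by rewrite ltr0n.
pose r := (e / (B + 1)) `^ alpha^-1 / d%:R.
have r0 : 0 < r by rewrite divr_gt0// powR_gt0// divr_gt0// ltr_wpDl.
have near_x : nbhs x [set y | forall i, `|x 0 i - y 0 i| <= r].
  apply/nbhs_ballP; exists r => //= y [_ xy] i.
  by have := xy 0 i => /ltW.
apply: filterS near_x => y xy; rewrite distrC.
have xyr : supnorm_le r (y - x).
  by move=> i; rewrite !mxE distrC.
have := holder_diff x aN a0 B0 uB (ltW r0) xyr; rewrite (addrC x) subrK.
move=> /le_trans; apply; rewrite /r mulrCA mulfV ?gt_eqF// mulr1 -powRrM mulVf ?gt_eqF//.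
rewrite powRr1; last by rewrite divr_ge0 ?(ltW e0)// addr_ge0.
rewrite mulrCA ler_piMr ?(ltW e0)// ler_pdivrMr ?ltr_wpDl// mul1r.
by rewrite lerDl.
Qed.

Lemma holder_space_continuous m alpha f : 0 < alpha -> (0 < d)%N ->
  holder_space m alpha f -> continuous f.
Proof.
move=> a0 d0 [+ fH]; case: m fH => [fH _|m _ [df _] x].
  have := fH (fun=> 0%N); rewrite /multi_order big1// multi_partialE partials_eq0//.
  by move=> /(_ erefl); exact: holder_continuous.
exact: differentiable_continuous.
Qed.

Lemma holder_space_norm_fin m alpha f : (0 < d)%N -> holder_space m alpha f ->
  holder_space_norm m alpha f \is a fin_num.
Proof.
move=> d0 [_ fH]; apply/sum_fin_numP => k _ /eqP km.
by rewrite ge0_fin_numE ?holder_seminorm_ge0//; have [] := fH _ km.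
Qed.

Lemma holder_seminorm_le_norm m alpha f k : (0 < d)%N -> multi_order k = m ->
  (holder_seminorm alpha (multi_partial k f) <= holder_space_norm m alpha f)%E.
Proof.
move=> d0 km; pose k' : {ffun 'I_d -> 'I_m.+1} := [ffun i => inord (k i)].
have k'E : (fun i => k' i : nat) = k.
  apply/funext => i; rewrite ffunE inordK// ltnS -km /multi_order.
  by rewrite (bigD1 i)//= leq_addr.
rewrite /holder_space_norm (bigD1 k') /=; last by rewrite k'E km.
by rewrite k'E leeDl// sume_ge0// => k1 _; exact: holder_seminorm_ge0.
Qed.

End HolderSpaceNorm.

(** * From partial sums to the upper limit *)

Section AlmostEverywhere.
Context {R : realType} {d : nat}.

Lemma lebesgue_almost_all_mono (P Q : 'rV[R]_d -> Prop) :
  (forall x, P x -> Q x) -> lebesgue_almost_all P -> lebesgue_almost_all Q.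
Proof.
move=> PQ P0; apply/eqP; rewrite eq_le lebesgue_outer_ge0 andbT -P0.
apply: le_ereal_inf => _ [ab [wab Pab] ->]; exists ab => //; split=> // x /= nQ.
by apply: Pab => /= Px; exact/nQ/PQ.
Qed.

End AlmostEverywhere.

Section Asymptotics.
Context {R : realType}.
Implicit Types (eps x : R).

Lemma ln2_ge_half : 2^-1 <= ln (2 : R).
Proof.
rewrite -ler_expR lnK ?posrE// -[leLHS]invrK -expRN -[leRHS]invrK.
rewrite lef_pV2 ?posrE ?invr_gt0 ?expR_gt0//.
by apply: le_trans (expR_ge1Dx _); lra.
Qed.

Definition lil_scale eps : R :=
  Num.sqrt (ln (1 / eps) * ln (ln (ln (1 / eps)))).

Lemma dyadic_scale eps : 0 < eps -> eps <= 1 ->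
  exists n, side n.+1 < eps <= side n.
Proof.
move=> e0 e1; have ex : exists n, side n.+1 < eps.
  have [|n _] := @side_powR_small R 1 0 (eps / 2) ltr01; first by rewrite divr_gt0.
  rewrite powRr1 ?(ltW (side_gt0 _))// => sn; exists n.
  by apply: (le_lt_trans (side_antimono (leqnSn n))); lra.
exists (ex_minn ex); case: ex_minnP => n sn nmin; rewrite sn /=.
case: n sn nmin => [|n] sn nmin; first by rewrite /side expr0.
rewrite leNgt; apply/negP => /nmin.
by rewrite ltnn.
Qed.

(** Here [ln (1 / eps)] is at least [2 ^+ k.-2], and its double logarithm is at
least [ln ((k - 2) / 2)], hence at least [ln k / 2] because [k <= ((k - 2) / 2) ^+ 2]
for large [k]. *)
Lemma deviation_le_lil_scale d n k eps : (12 <= k)%N -> (2 ^ k.-1 < n)%N ->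
  0 < eps -> eps <= side n ->
  3 + @deviation R d k <= (3 + 24 * (d.+3)%:R) * lil_scale eps.
Proof.
move=> k12 kn e0 en; pose L := ln (1 / eps).
have lnk : 2^-1 <= ln (k%:R : R).
  apply: (le_trans ln2_ge_half); rewrite ler_ln ?posrE ?ltr0n ?ler_nat//; lia.
have k12R : 12 <= k%:R :> R by rewrite ler_nat.
have kE : (k.-1 = k.-2.+1)%N by lia.
have L1 : 2 ^+ k.-2 <= L.
  apply: (@le_trans _ _ (n%:R * ln 2)).
    apply: (@le_trans _ _ ((2 ^ k.-1)%:R * 2^-1)).
      by rewrite kE natrX exprS mulrAC mulfV// mul1r.
    by rewrite ler_pM ?ln2_ge_half// ler_nat ltnW.
  rewrite mulr_natl -lnXn// /L ler_ln ?posrE ?exprn_gt0 ?divr_gt0//.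
  rewrite ler_pdivlMr//; apply: (le_trans (ler_wpM2l _ en)); first exact: exprn_ge0.
  by rewrite /side -exprMn mulfV// expr1n.
have L0 : 0 < L by apply: lt_le_trans L1; rewrite exprn_gt0.
have L2 : (k%:R - 2) / 2 <= ln L.
  apply: (@le_trans _ _ (ln (2 ^+ k.-2))); last first.
    by rewrite ler_ln ?posrE ?exprn_gt0.
  rewrite lnXn// -[leRHS]mulr_natl ler_pM ?ln2_ge_half//; first by lra.
  by rewrite lerBlDr -natrD ler_nat; lia.
have lnL0 : 0 < ln L by apply: lt_le_trans L2; lra.
have L3 : ln k%:R / 2 <= ln (ln L).
  apply: (@le_trans _ _ (ln ((k%:R - 2) / 2))); last first.
    rewrite ler_ln ?posrE//; lra.
  rewrite ler_pdivrMr// mulrC mulr_natl -lnXn; last by lra.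
  rewrite ler_ln ?posrE; [nra|lra|].
  by rewrite exprn_gt0//; lra.
have W : 2 ^+ k * ln k%:R / 8 <= L * ln (ln L).
  have -> : 2 ^+ k * ln k%:R / 8 = 2 ^+ k.-2 * (ln (k%:R : R) / 2).
    by rewrite -[in 2 ^+ k](_ : k.-2.+2 = k) ?exprS; [field|lia].
  by rewrite ler_pM ?exprn_ge0//; lra.
have k0 : 0 <= 2 ^+ k * ln k%:R / 8 :> R.
  by rewrite divr_ge0// mulr_ge0 ?exprn_ge0//; lra.
have W1 : 1 <= lil_scale eps.
  rewrite /lil_scale -/L -sqrtr1 ler_wsqrtr// (le_trans _ W)//.
  have h : 2 ^+ 4 <= 2 ^+ k :> R by rewrite ler_eXn2l ?ltr1n//; lia.
  by move: h; rewrite !exprS expr0; nra.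
have Dev : @deviation R d k <= 24 * (d.+3)%:R * lil_scale eps.
  apply: (@le_trans _ _ (24 * (d.+3)%:R * Num.sqrt (2 ^+ k * ln k%:R / 8))); last first.
    by rewrite ler_wpM2l ?mulr_ge0// /lil_scale -/L ler_wsqrtr.
  have c0 : 0 <= 24 * (d.+3)%:R :> R by rewrite mulr_ge0.
  rewrite -[X in X * Num.sqrt _](ger0_norm c0) -sqrtr_sqr -sqrtrM ?sqr_ge0//.
  rewrite /deviation ler_wsqrtr//.
  have d3 : 1 <= (d.+3)%:R :> R by rewrite ler1n.
  set q := (d.+3)%:R in d3 *.
  rewrite (_ : (24 * q) ^+ 2 * _ = q * (72 * q * 2 ^+ k * ln k%:R)); last by field.
  by rewrite ler_peMl// !mulr_ge0 ?exprn_ge0//; lra.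
by rewrite mulrDl; lra.
Qed.

Lemma limf_esup_right_le (g : R -> \bar R) (v : \bar R) (delta : R) : 0 < delta ->
  (forall eps, 0 < eps < delta -> (g eps <= v)%E) -> (limf_esup g 0^'+ <= v)%E.
Proof.
move=> d0 gv; apply: (@le_trans _ _ (ereal_sup (g @` [set eps | 0 < eps < delta]))).
  apply: ereal_inf_lbound => /=; exists [set eps | 0 < eps < delta] => //.
  near=> eps; apply/andP; split.
    by near: eps; exact: nbhs_right_gt.
  by near: eps; exact: nbhs_right_lt.
by apply: ge_ereal_sup => _ [eps epsd <-]; exact: gv.
Unshelve. all: by end_near. Qed.

End Asymptotics.

Lemma compact_supnorm_le (R : realType) (d : nat) (K : set 'rV[R]_d) : compact K ->
  exists2 rho : R, 1 <= rho & forall w, K w -> supnorm_le rho w.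
Proof.
move=> cK; have /choice[E EP] : forall i : 'I_d, exists E : R,
    0 <= E /\ forall w, K w -> `|w 0 i| <= E.
  move=> i; have [E E0 KE] := continuous_bounded_compact cK
    (@coord_continuous R 1 d 0 i).
  by exists E.
have E0 i : 0 <= E i by have [] := EP i.
exists (1 + \sum_i E i) => [|w Kw i]; first by rewrite lerDl sumr_ge0.
apply: (le_trans ((EP i).2 w Kw)); rewrite (bigD1 i)//= addrCA lerDl.
by rewrite addr_ge0// sumr_ge0.
Qed.

Lemma multi_order_le_floor (R : realType) (m n : nat) (alpha : R) : 0 < alpha <= 1 ->
  (n <= m + (alpha == 1%R))%N -> n%:Z <= Num.floor (m%:R + alpha).
Proof.
move=> /andP[a0 a1] nm; rewrite floor_ge_int.
apply: (@le_trans _ _ (m + (alpha == 1%R))%:R); first by rewrite -pmulrn ler_nat.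
rewrite natrD lerD2l; case: eqP => [->//|_].
exact: ltW.
Qed.

Lemma Theta_le_partial_sum (R : realType) (d m : nat) (alpha : R)
    (sigma : {charge set (borel_rV R d) -> \bar R}) (K : set 'rV[R]_d)
    (f : 'rV[R]_d -> R) (x : 'rV[R]_d) (E eps : R) (n : nat) :
  compact K -> Defs.total_variation sigma (~` K) = 0%E -> continuous f ->
  side n.+1 < eps <= side n ->
  (forall a b, 0 < a -> a <= b <= 2 * a ->
     `|\int[@lebesgue_measure R]_(h in `[a, b]) integrand sigma m alpha f x h| <= E) ->
  `|Theta sigma m alpha eps f x| <= `|@partial_sum R d m alpha sigma f n x| + E.
Proof.
move=> cK sigmaK cf /andP[ne en] segE.
have e0 : 0 < eps by apply: lt_trans ne; exact: side_gt0.
have -> : Theta sigma m alpha eps f x =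
  \int[@lebesgue_measure R]_(h in `[eps, 1]) integrand sigma m alpha f x h by [].
rewrite (integral_dyadic_split cK sigmaK m alpha x cf e0 en).
apply: (le_trans (ler_normD _ _)); apply: lerD.
  by rewrite /partial_sum big_mkord.
apply: segE => //; rewrite en /=.
by rewrite (sideS n); lra.
Qed.

Lemma integral_estimates (R : realType) (d m : nat) (alpha : R)
    (sigma : {charge set (borel_rV R d) -> \bar R}) (K : set 'rV[R]_d) :
  (0 < d)%N -> 0 < alpha <= 1 ->
  compact K -> Defs.total_variation sigma (~` K) = 0%E ->
  (forall k : 'I_d -> nat, (multi_order k <= m + (alpha == 1%R))%N ->
     charge_integral sigma (monomial k) = 0) ->
  exists2 c : R, 0 < c & forall f (B : R), 0 <= B -> holder_space m alpha f ->
    (holder_space_norm m alpha f <= B%:E)%E ->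
    (forall a b x, 0 < a -> a <= b <= 2 * a ->
      `|\int[@lebesgue_measure R]_(h in `[a, b]) integrand sigma m alpha f x h|
        <= c * B) /\
    (forall N, exists X : nat -> 'rV[R]_d -> R,
      (forall i y, (i < N)%N ->
        X i y = 2^-1 ^+ d * \sum_a X i.+1 (y + side i.+1 *: bits a)) /\
      (forall i y x, (i <= N)%N -> cube (side i) y x ->
        `|@partial_sum R d m alpha sigma f i x - X i y| <= c * B)).
Proof.
move=> d0 a01 cK sigmaK moments; have [a0 a1] := andP a01.
have [rho rho1 Krho] := compact_supnorm_le cK.
have [beta [CH [b0 ba b1 CH0 approx]]] := holder_approx d0 a01.
have [CT CT0 taylor] := @comb_polynomial_approx R d (alpha == 1) m.
pose ci := @increment_const R d m alpha sigma rho CT CH.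
pose cm := @martingale_const R d m alpha sigma rho CT beta CH.
exists (1 + `|ci| + `|cm|) => [|f B B0 fH fB].
  by rewrite ltr_wpDr// ltr_wpDr.
have fc := holder_space_continuous a0 d0 fH.
have fHB k : multi_order k = m -> holder alpha (multi_partial k f) /\
    (holder_seminorm alpha (multi_partial k f) <= B%:E)%E.
  move=> km; split; first by have [_] := fH; apply.
  exact: le_trans (holder_seminorm_le_norm _ _ d0 km) fB.
have fd : times_differentiable m f by have [] := fH.
have ciB : ci * B <= (1 + `|ci| + `|cm|) * B.
  by rewrite ler_wpM2r//; have := ler_norm ci; have := normr_ge0 cm; lra.
have cmB : cm * B <= (1 + `|ci| + `|cm|) * B.
  by rewrite ler_wpM2r//; have := ler_norm cm; have := normr_ge0 ci; lra.
split=> [a b x aa ab|N].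
  apply: le_trans ciB; exact: (segment_le a0 a1 cK sigmaK rho1 Krho moments CT0
    taylor CH0 approx B0 fd fc fHB).
have [X [XE SX]] := partial_sum_means a0 a1 cK sigmaK rho1 Krho moments CT0
    taylor b0 ba b1 CH0 approx B0 fd fc fHB N.
exists X; split=> // i y x iN yx; apply: le_trans cmB; exact: SX.
Qed.

Theorem theorem1p1 (R : realType) (d m : nat) (alpha : R)
    (sigma : {charge set (borel_rV R d) -> \bar R}) :
  (0 < d)%N -> 0 < alpha <= 1 ->
  compactly_supported sigma ->
  (forall k : 'I_d -> nat, (multi_order k)%:Z <= Num.floor (m%:R + alpha) ->
     charge_integral sigma (monomial k) = 0) ->
  exists2 C : R, 0 < C &
    forall f : 'rV[R]_d -> R, holder_space m alpha f ->
      lebesgue_almost_all (fun x =>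
        (limf_esup (fun eps : R =>
           (`|Theta sigma m alpha eps f x| /
            Num.sqrt (ln (1 / eps) * ln (ln (ln (1 / eps)))))%:E) 0^'+
         <= C%:E * holder_space_norm m alpha f)%E).
Proof.
move=> d0 a01 [K cK sigmaK] moments.
have [|c c0 est] := integral_estimates d0 a01 cK sigmaK (m := m).
  by move=> k km; apply: moments; exact: multi_order_le_floor.
pose C := c * (3 + 24 * (d.+3)%:R).
exists C => [|f fH]; first by rewrite mulr_gt0// addr_gt0// mulr_gt0.
have normfin := holder_space_norm_fin d0 fH.
set B := fine (holder_space_norm m alpha f).
have B0 : 0 <= B.
  by rewrite fine_ge0// sume_ge0// => k _; exact: holder_seminorm_ge0.
have fB : (holder_space_norm m alpha f <= B%:E)%E by rewrite fineK.
have [segB means] := est f B B0 fH fB.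
have fc := holder_space_continuous (proj1 (andP a01)) d0 fH.
pose S := @partial_sum R d m alpha sigma f.
have TS x n eps : side n.+1 < eps <= side n ->
    `|Theta sigma m alpha eps f x| <= `|S n x| + c * B.
  move=> en; apply: Theta_le_partial_sum cK sigmaK fc en _ => a b aa ab.
  exact: segB.
(* [iterated_logarithm] requires a positive bound for the increments, also if
   the seminorm of [f] vanishes. *)
pose c' := if B == 0 then 1 else c * B.
have cc' : c * B <= c'.
  by rewrite /c'; case: eqP => // ->; rewrite mulr0.
have c'0 : 0 < c'.
  by rewrite /c'; case: eqP => // /eqP BN; rewrite mulr_gt0// lt_neqAle eq_sym BN.
have increment_le j x : `|S j.+1 x - S j x| <= c * B.
  rewrite /S /partial_sum big_nat_recr//= addrAC subrr add0r.
  apply: segB; first exact: side_gt0.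
  by have := @side_gt0 R j.+1; rewrite (sideS j); lra.
have := @iterated_logarithm R d c' S d0 c'0.
move=> /(_ _)/wrap[x|]; first by rewrite /S /partial_sum big_geq.
move=> /(_ _)/wrap[i x|]; first exact: le_trans cc'.
move=> /(_ _)/wrap[N|].
  have [X [XE SX]] := means N; exists X; split=> // i y x iN yx.
  exact: le_trans (SX i y x iN yx) cc'.
apply: lebesgue_almost_all_mono => x [k0 Sk].
rewrite -(fineK normfin) -/B -EFinM.
have [BE|BN] := eqVneq B 0.
  have S0 n : S n x = 0.
    elim: n => [|n IH]; first by rewrite /S /partial_sum big_geq.
    by have := increment_le n x; rewrite IH BE mulr0 subr0 normr_le0 => /eqP.
  apply: (limf_esup_right_le ltr01) => eps /andP[e0 e1].
  have [n en] := dyadic_scale e0 (ltW e1).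
  have := TS x n eps en; rewrite S0 BE mulr0 normr0 addr0 normr_le0 => /eqP ->.
  by rewrite normr0 mul0r mulr0.
have c'E : c' = c * B by rewrite /c' (negbTE BN).
pose k1 := maxn k0 12.
apply: (limf_esup_right_le (@side_gt0 R (2 ^ k1).+1)) => eps /andP[e0 e1].
have [n /andP[ne en]] := dyadic_scale e0 (ltW (lt_le_trans e1 (side_le1 _))).
have k1n : (2 ^ k1 < n)%N.
  rewrite ltnNge; apply/negP => nk; have : side (2 ^ k1).+1 <= side n.+1 :> R.
    by apply: side_antimono.
  by rewrite leNgt (lt_trans ne e1).
have n1 : (1 < n)%N by apply: leq_ltn_trans k1n; rewrite expn_gt0.
have /andP[kn nk] := up_log_bounds (ltnSn 1) n1.
set k := up_log 2 n in kn nk.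
have k1k : (k1 < k)%N by rewrite -(ltn_exp2l _ _ (ltnSn 1)) (leq_trans k1n).
have k12 : (12 <= k)%N by rewrite (leq_trans _ (ltnW k1k))// leq_maxr.
have k0k : (k0 <= k)%N by rewrite (leq_trans _ (ltnW k1k))// leq_maxl.
have dev := @deviation_le_lil_scale R d n k eps k12 kn e0 en.
have W0 : 0 < lil_scale eps.
  have : 0 < 3 + @deviation R d k by rewrite ltr_wpDr// sqrtr_ge0.
  by move=> /lt_le_trans /(_ dev); rewrite pmulr_rgt0//.
rewrite lee_fin ler_pdivrMr//.
have := TS x n eps; rewrite ne en => /(_ isT) /le_trans; apply.
have := Sk k k0k n nk; rewrite c'E => Sn.
apply: (@le_trans _ _ (c * B * (3 + @deviation R d k))); first by lra.
apply: le_trans (ler_wpM2l (mulr_ge0 (ltW c0) B0) dev) _.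
by rewrite /C le_eqVlt; apply/orP; left; apply/eqP; rewrite /lil_scale; ring.
Qed.
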